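(* Let $\mathfrak R$ be a topologically semiperfect topological ring with a countable base of open neighborhoods of zero and let $\mathfrak P$ be a projective left $\mathfrak R$-contramodule. Then $\mathfrak P$ decomposes, in the category of left $\mathfrak R$-contramodules, as a coproduct $\mathfrak P=\coprod_{x\in X}\mathfrak P_x$, where each $\mathfrak P_x$ is a projective cover of a simple contramodule (i.e. $\mathfrak P_x\simeq\mathfrak R e_x$ for a local idempotent $e_x\in\mathfrak R$).
   Context: All rings are associative and unital. All topological rings are complete, separated and right linear: open right ideals $\mathfrak I$ form a base of neighborhoods of zero and $\mathfrak R\to\varprojlim_{\mathfrak I}\mathfrak R/\mathfrak I$ is bijective. A family $(r_x)_{x\in X}$ in $\mathfrak R$ is zero-convergent if every open right ideal contains $r_x$ for all but finitely many $x$; infinite sums of zero-convergent families are limits of finite partial sums. A nonzero ring is local if its noninvertible elements form an additive subgroup; an idempotent $e\in\mathfrak R$ is local if the ring $e\mathfrak Re$ is local. $\mathfrak R$ is topologically semiperfect if there exist a set $Z$ and a zero-convergent family $(e_z)_{z\in Z}$ of pairwise orthogonal idempotents in $\mathfrak R$ with $\sum_{z\in Z}e_z=1$ such that every ring $e_z\mathfrak R e_z$ is local. Contramodules: for a set $X$, $\mathfrak R[[X]]$ is the set of formal sums $\sum_{x\in X}r_xx$ with $(r_x)$ a zero-convergent family in $\mathfrak R$. For a map $f:X\to Y$, $\mathfrak R[[f]]$ sends $\sum_x r_xx$ to $\sum_y\bigl(\sum_{f(x)=y}r_x\bigr)y$. The functor $X\mapsto\mathfrak R[[X]]$ is a monad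 on sets, with unit $\epsilon_X:x\mapsto 1\cdot x$ and multiplication $\phi_X:\mathfrak R[[\mathfrak R[[X]]]]\to\mathfrak R[[X]]$, $\sum_i r_i\bigl(\sum_x s_{i,x}x\bigr)\mapsto\sum_x\bigl(\sum_i r_is_{i,x}\bigr)x$. A left $\mathfrak R$-contramodule is an algebra over this monad, i.e. a set $\mathfrak C$ with a contraaction map $\pi_{\mathfrak C}:\mathfrak R[[\mathfrak C]]\to\mathfrak C$ such that $\pi_{\mathfrak C}\circ\mathfrak R[[\pi_{\mathfrak C}]]=\pi_{\mathfrak C}\circ\phi_{\mathfrak C}$ and $\pi_{\mathfrak C}\circ\epsilon_{\mathfrak C}=\mathrm{id}$; morphisms are morphisms of algebras over the monad. Left $\mathfrak R$-contramodules form an abelian category with products, coproducts and enough projectives; the free contramodules are $\mathfrak R[[X]]$ with contraaction $\phi_X$ (in particular $\mathfrak R$ itself), and the projective ones are the direct summands of free ones. For an idempotent $e\in\mathfrak R$, $\mathfrak Re$ is a subcontramodule and direct summand of $\mathfrak R$. A contramodule is simple if it is a simple object of the category of contramodules. A projective cover of an object $C$ in an abelian category is an epimorphism $p:P\to C$ with $P$ projective and superfluous kernel (equivalently, such that every endomorphism $f$ of $P$ with $pf=p$ is invertible). *)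

(* Defs.v *)
From HB Require Import structures.
From mathcomp Require Import all_boot all_order all_algebra finmap.
From mathcomp Require Import boolp classical_sets functions cardinality.
From mathcomp Require Import topology tvs.

Set Implicit Arguments.
Unset Strict Implicit.
Unset Printing Implicit Defensive.

Import GRing.Theory.
Local Open Scope classical_set_scope.
Local Open Scope ring_scope.

(* pzRingType: the zero ring is allowed. *)
HB.mixin Record isTopologicalPzRing R & TopologicalZmodule R & GRing.PzRing R :=
  { mul_continuous : continuous (fun x : R * R => x.1 * x.2) }.

#[short(type="topologicalPzRingType")]
HB.structure Definition TopologicalPzRing :=
  {R of TopologicalZmodule R & GRing.PzRing R & isTopologicalPzRing R}.

Definition open_right_ideal (R : topologicalPzRingType) (I : set R) : Prop :=
  [/\ open I, I 0, (forall x y, I x -> I y -> I (x - y))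
    & (forall x r, I x -> I (x * r))].

(* An element of the projective limit of the R/I is encoded by a choice [a I]
   of representatives of its components. *)
Definition compatible (R : topologicalPzRingType) (a : set R -> R) : Prop :=
  forall I J, open_right_ideal I -> open_right_ideal J -> I `<=` J ->
    J (a I - a J).

(* Existence (resp. uniqueness) in the second axiom is surjectivity (resp.
   injectivity) of the map from R to the projective limit of the R/I. *)
HB.mixin Record isCompleteRightLinear R & TopologicalPzRing R := {
  right_linear : forall U : set R, nbhs (0 : R) U ->
    exists2 I : set R, open_right_ideal I & I `<=` U ;
  complete_separated : forall a : set R -> R, compatible a ->
    exists! s : R, forall I : set R, open_right_ideal I -> I (s - a I) }.

#[short(type="crlTopRingType")]
HB.structure Definition CRLTopRing :=
  {R of TopologicalPzRing R & isCompleteRightLinear R}.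

Definition countable_base_at_zero (R : crlTopRingType) : Prop :=
  exists B : set (set R),
    [/\ countable B, (forall U, B U -> open_nbhs (0 : R) U)
      & (forall V, nbhs (0 : R) V -> exists2 U, B U & U `<=` V)].

Section InfiniteSums.
Variables (R : crlTopRingType) (X : Type).
Implicit Types (r : X -> R) (s : R).

Definition zero_convergent r : Prop :=
  forall I, open_right_ideal I -> finite_set [set x | ~ I (r x)].

Definition fset_dir : set_system {fset {classic X}} :=
  filter_from setT (fun A => [set B : {fset {classic X}} | (A `<=` B)%fset]).

Definition is_sum r s : Prop :=
  (fun A : {fset {classic X}} => \sum_(x <- A) r x) @ fset_dir --> s.

(* Total: only meaningful when the partial sums converge, as they do for
   zero-convergent families (topsumP below); 0 otherwise. *)
Definition topsum r : R := xget 0 [set s | is_sum r s].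

End InfiniteSums.

Section IdealTheory.
Variables (R : crlTopRingType) (I : set R).
Hypothesis oriI : open_right_ideal I.

Lemma ori0 : I 0. Proof. by case: oriI. Qed.
Lemma oriB x y : I x -> I y -> I (x - y).
Proof. by case: oriI => _ _ + _; apply. Qed.
Lemma oriM x r : I x -> I (x * r).
Proof. by case: oriI => _ _ _; apply. Qed.
Lemma oriN x : I x -> I (- x).
Proof. by move=> Ix; rewrite -sub0r; apply: oriB => //; exact: ori0. Qed.
Lemma oriD x y : I x -> I y -> I (x + y).
Proof. by move=> Ix Iy; rewrite -[y]opprK; apply: oriB => //; exact: oriN. Qed.
Lemma ori_sum (T : Type) (l : seq T) (P : pred T) (F : T -> R) :
  (forall x, P x -> I (F x)) -> I (\sum_(x <- l | P x) F x).
Proof.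
by move=> IF; elim/big_ind : _ => //; [exact: ori0|exact: oriD].
Qed.
Lemma oriBC x y : I (x - y) -> I (y - x).
Proof. by rewrite -(opprB x y); exact: oriN. Qed.
Lemma ori_trans y x z : I (x - y) -> I (y - z) -> I (x - z).
Proof. by move=> xy yz; rewrite -(subrKA y); exact: oriD. Qed.

Lemma ori_nbhs s : nbhs s [set x | I (s - x)].
Proof.
have cs : continuous (fun x : R => s - x).
  move=> x; apply: (@continuous_comp _ _ _ (fun x => (s, x))
    (fun x : R * R => x.1 - x.2)); last exact: sub_continuous.
  by apply: cvg_pair => /=; [exact: cvg_cst|exact: cvg_id].
apply: (cs s); rewrite subrr; apply: open_nbhs_nbhs; split; last exact: ori0.
by case: oriI.
Qed.

End IdealTheory.

Section SumTheory.
Variable R : crlTopRingType.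

Lemma ori_sep (x y : R) : (forall I, open_right_ideal I -> I (x - y)) -> x = y.
Proof.
move=> xy; have cy : compatible (fun=> y).
  by move=> I J oI oJ _; rewrite subrr; exact: ori0.
have [s [_ us]] := @complete_separated R _ cy.
rewrite -(us x) // -(us y) // => I oI; rewrite subrr; exact: ori0.
Qed.

Lemma ori_mull (a : R) I : open_right_ideal I ->
  open_right_ideal [set x | I (a * x)].
Proof.
move=> oI; split => /=.
- have ca : continuous (fun x : R => a * x).
    move=> x; apply: (@continuous_comp _ _ _ (fun x => (a, x))
      (fun x : R * R => x.1 * x.2)); last exact: mul_continuous.
    by apply: cvg_pair => /=; [exact: cvg_cst|exact: cvg_id].
  by move/continuousP : ca; apply; case: oI.
- by rewrite mulr0; exact: ori0.
- by move=> x y Ix Iy; rewrite mulrBr; exact: oriB.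
- by move=> x r Ix; rewrite mulrA; exact: oriM.
Qed.

Lemma sum_supp (X : choiceType) (I : set R) (r : X -> R) (A B : {fset X}) :
  open_right_ideal I -> (A `<=` B)%fset -> (forall x, x \notin A -> I (r x)) ->
  I (\sum_(x <- B) r x - \sum_(x <- A) r x).
Proof.
move=> oI /fsubsetP AB Ir.
rewrite (big_fsetID _ [in A]) /=.
have -> : [fset x in B | x \in A]%fset = A.
  by apply/fsetP => x; rewrite !inE/= andb_idl// => /AB.
rewrite addrC addrK big_seq; apply: ori_sum => // x.
by rewrite !inE/= => /andP[_]; exact: Ir.
Qed.

Section Index.
Variable X : Type.
Implicit Types r : X -> R.

Definition bad (I : set R) r : {fset {classic X}} :=
  fset_set ([set x | ~ I (r x)] : set {classic X}).

Lemma badP I r x : zero_convergent r -> open_right_ideal I ->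
  (x : {classic X}) \notin bad I r -> I (r x).
Proof.
move=> zr oI; rewrite in_fset_set ?inE/=; last exact: zr.
by apply: contraNP => nI; rewrite inE.
Qed.

#[local] Instance fset_dir_filter : ProperFilter (@fset_dir X).
Proof.
apply: filter_from_proper; last by move=> A _; exists A => /=.
apply: filter_from_filter; first by exists fset0.
move=> A B _ _; exists (A `|` B)%fset => // C /= ABC.
by split=> /=; apply: fsubset_trans ABC; rewrite ?fsubsetUl ?fsubsetUr.
Qed.

Lemma is_sumP r s : (is_sum r s <-> forall I, open_right_ideal I ->
  exists A : {fset {classic X}}, forall B : {fset {classic X}},
    (A `<=` B)%fset -> I (s - \sum_(x <- B) r x)).
Proof.
split=> [rs I oI|H U Us].
  by have [A _ AB] := rs _ (ori_nbhs oI s); exists A.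
have : nbhs (0 : R) [set x | U (s - x)].
  have cs : continuous (fun x : R => s - x).
    move=> x; apply: (@continuous_comp _ _ _ (fun x => (s, x))
      (fun x : R * R => x.1 - x.2)); last exact: sub_continuous.
    by apply: cvg_pair => /=; [exact: cvg_cst|exact: cvg_id].
  by apply: (cs 0); rewrite subr0.
move=> /right_linear[I oI IU]; have [A AP] := H _ oI.
exists A => // B /= /AP /IU /=; by rewrite opprB addrC subrK.
Qed.

Lemma topsumP r : zero_convergent r -> is_sum r (topsum r).
Proof.
move=> zr.
have cr : compatible (fun I => \sum_(x <- bad I r) r x).
  move=> I J oI oJ IJ.
  apply: sum_supp => //; last by move=> x; exact: badP.
  apply/fsubsetP => x; apply: contraLR => xI.
  rewrite in_fset_set; last exact: zr.
  by apply/negP; rewrite inE/=; apply; apply: IJ; exact: badP xI.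
have [s [Hs _]] := @complete_separated R _ cr.
apply: (@xgetI _ _ [set s | is_sum r s] s).
apply/is_sumP => I oI; exists (bad I r) => B AB.
apply: (ori_trans oI (Hs _ oI)); apply: oriBC => //.
by apply: sum_supp => // x; exact: badP.
Qed.

Lemma topsum_approx r I (A : {fset {classic X}}) : zero_convergent r ->
  open_right_ideal I -> (forall x : {classic X}, x \notin A -> I (r x)) ->
  I (topsum r - \sum_(x <- A) r x).
Proof.
move=> zr oI Ir; have /is_sumP/(_ _ oI)[B HB] := topsumP zr.
apply: (ori_trans oI (HB (A `|` B)%fset _)); first exact: fsubsetUr.
by apply: sum_supp => //; exact: fsubsetUl.
Qed.

Lemma topsum_in r I : zero_convergent r -> open_right_ideal I ->
  (forall x, I (r x)) -> I (topsum r).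
Proof.
move=> zr oI Ir; have := @topsum_approx r I fset0 zr oI (fun x _ => Ir x).
by rewrite big_seq_fset0 subr0.
Qed.

Lemma zero_convergent_sub r r' : zero_convergent r ->
  (forall I x, open_right_ideal I -> I (r x) -> I (r' x)) -> zero_convergent r'.
Proof.
by move=> zr rr' I oI; apply: sub_finite_set (zr _ oI) => x /= nI /(rr' _ _ oI).
Qed.

Lemma topsum_single r x0 : (forall x, x <> x0 -> r x = 0) ->
  zero_convergent r /\ topsum r = r x0.
Proof.
move=> r0; have zr : zero_convergent r.
  move=> I oI; apply: (@sub_finite_set _ _ [set x0]) => // x /= nI.
  by apply: contrapT => xx0; apply: nI; rewrite r0//; exact: ori0.
split=> //; apply: ori_sep => I oI.
have := @topsum_approx r I [fset (x0 : {classic X})]%fset zr oI.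
rewrite big_seq_fset1; apply => x; rewrite inE => /eqP xx0.
by rewrite r0 //; exact: ori0.
Qed.

Lemma zero_convergent_mull a r : zero_convergent r ->
  zero_convergent (fun x => a * r x).
Proof. by move=> zr I oI; exact: zr (ori_mull a oI). Qed.

Lemma topsum_mull a r : zero_convergent r ->
  topsum (fun x => a * r x) = a * topsum r.
Proof.
move=> zr; apply: ori_sep => I oI.
have zar := zero_convergent_mull a zr.
have H1 := topsum_approx zar oI (fun x => @badP I _ x zar oI).
apply: (ori_trans oI H1); apply: (oriBC oI).
rewrite -mulr_sumr -mulrBr.
apply: (topsum_approx zr (ori_mull a oI)) => x.
exact: (@badP I _ x zar oI).
Qed.

Lemma zero_convergent_mulr r (s : X -> R) : zero_convergent r ->
  zero_convergent (fun x => r x * s x).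
Proof.
by move=> zr; apply: zero_convergent_sub zr _ => I x oI; exact: oriM.
Qed.

Lemma topsum_mulr r a : zero_convergent r ->
  topsum (fun x => r x * a) = topsum r * a.
Proof.
move=> zr; apply: ori_sep => I oI.
have zra := zero_convergent_mulr (fun=> a) zr.
have bI (x : {classic X}) : x \notin bad I r -> I (r x * a).
  by move=> /(badP zr oI) /oriM; exact.
apply: (ori_trans oI (topsum_approx zra oI bI)); apply: (oriBC oI).
rewrite -mulr_suml -mulrBl; apply: oriM => //.
by apply: topsum_approx => // x; exact: badP.
Qed.

End Index.

Definition fiber_part (X Y : Type) (f : X -> Y) (r : X -> R) (y : Y) (x : X) : R :=
  if `[< f x = y >] then r x else 0.

Lemma zero_convergent_fiber X Y (f : X -> Y) r y :
  zero_convergent r -> zero_convergent (fiber_part f r y).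
Proof.
move=> zr; apply: zero_convergent_sub zr _ => I x oI; rewrite /fiber_part.
by case: ifP => // _ _; exact: ori0.
Qed.

Lemma zero_convergent_push X Y (f : X -> Y) r :
  zero_convergent r -> zero_convergent (fun y => topsum (fiber_part f r y)).
Proof.
move=> zr I oI; apply: sub_finite_set (finite_image f (zr _ oI)) => y /= nI.
apply: contrapT => ny; apply: nI; apply: topsum_in => //.
  exact: zero_convergent_fiber.
move=> x; rewrite /fiber_part; case: asboolP => [fxy|_]; last exact: ori0.
by apply: contrapT => nIx; apply: ny; exists x.
Qed.

Lemma topsum_push X Y (f : X -> Y) r : zero_convergent r ->
  topsum (fun y => topsum (fiber_part f r y)) = topsum r.
Proof.
move=> zr; apply: ori_sep => I oI.
pose F := bad I r.
pose G : {fset {classic Y}} := ((f : {classic X} -> {classic Y}) @` F)%fset.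
have fF y (x : {classic X}) : x \notin F -> I (fiber_part f r y x).
  move=> xF; rewrite /fiber_part; case: ifP => _; last exact: ori0.
  exact: (badP zr oI).
have fG (y : {classic Y}) : y \notin G -> I (topsum (fiber_part f r y)).
  move=> yG; apply: topsum_in => //; first exact: zero_convergent_fiber.
  move=> x; have [xF|/fF//] := boolP ((x : {classic X}) \in F).
  rewrite /fiber_part; case: asboolP => [fxy|_]; last exact: ori0.
  by case/negP : yG; apply/imfsetP; exists x.
apply: (ori_trans oI (topsum_approx (zero_convergent_push f zr) oI fG)).
apply: (@ori_trans _ _ oI (\sum_(y <- G) \sum_(x <- F) fiber_part f r y x)).
  rewrite -sumrB; apply: ori_sum => // y _.
  by apply: topsum_approx => //; [exact: zero_convergent_fiber|exact: fF].
have -> : \sum_(y <- G) \sum_(x <- F) fiber_part f r y x = \sum_(x <- F) r x.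
  rewrite exchange_big/= big_seq [RHS]big_seq; apply: eq_bigr => x xF.
  have fxG : (f x : {classic Y}) \in G by apply/imfsetP; exists x.
  rewrite (big_fsetD1 _ fxG)/= {1}/fiber_part asboolT// big_seq big1 ?addr0//.
  move=> y; rewrite !inE => /andP[/eqP yfx _].
  by rewrite /fiber_part asboolF// => /esym.
by apply: (oriBC oI); apply: topsum_approx => // x; exact: badP.
Qed.

Lemma topsum_pair X Y (q : X * Y -> R) : zero_convergent q ->
  topsum (fun x => topsum (fun y => q (x, y))) = topsum q /\
  topsum (fun y => topsum (fun x => q (x, y))) = topsum q.
Proof.
move=> zq; rewrite -{1}(topsum_push fst zq) -(topsum_push snd zq); split.
- congr topsum; apply/funext => x.
  have zx : zero_convergent (fun y => q (x, y)).
    move=> I oI; apply: sub_finite_set (finite_image snd (zq _ oI)) => y /= nI.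
    by exists (x, y).
  rewrite -(topsum_push (pair x) zx); congr topsum; apply/funext => -[x' y'].
  have [|_ ->] := @topsum_single _ (fiber_part (pair x) (fun y => q (x, y)) (x', y')) y'.
    move=> y yy'; rewrite /fiber_part asboolF// => -[]; tauto.
  rewrite /fiber_part/=; case: asboolP => [[<-]|nx]; first by rewrite asboolT.
  by rewrite asboolF// => xx'; apply: nx; rewrite xx'.
- congr topsum; apply/funext => y.
  have zy : zero_convergent (fun x => q (x, y)).
    move=> I oI; apply: sub_finite_set (finite_image fst (zq _ oI)) => x /= nI.
    by exists (x, y).
  rewrite -(topsum_push (pair^~ y) zy); congr topsum; apply/funext => -[x' y'].
  have [|_ ->] := @topsum_single _ (fiber_part (pair^~ y) (fun x => q (x, y)) (x', y')) x'.
    move=> x xx'; rewrite /fiber_part asboolF// => -[]; tauto.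
  rewrite /fiber_part/=; case: asboolP => [[<-]|ny]; first by rewrite asboolT.
  by rewrite asboolF// => yy'; apply: ny; rewrite yy'.
Qed.

Lemma zero_convergent_comb X Y (r : X -> R) (s : X -> Y -> R) :
  zero_convergent r -> (forall x, zero_convergent (s x)) ->
  zero_convergent (fun p : X * Y => r p.1 * s p.1 p.2).
Proof.
move=> zr zs I oI.
apply: (@sub_finite_set _ _ (\bigcup_(x in [set x | ~ I (r x)])
  [set (x, y) | y in [set y | ~ I (r x * s x y)]])).
  move=> [x y] /= nI; exists x => /=; first by apply: contra_not nI; exact: oriM.
  by exists y.
apply: bigcup_finite; first exact: zr.
move=> x _; apply: finite_image; exact: (zero_convergent_mull (r x) (zs x)).
Qed.

Lemma zero_convergent_comb_sum X Y (r : X -> R) (s : X -> Y -> R) :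
  zero_convergent r -> (forall x, zero_convergent (s x)) ->
  zero_convergent (fun y => topsum (fun x => r x * s x y)).
Proof.
move=> zr zs I oI; have zq := zero_convergent_comb zr zs.
apply: sub_finite_set (finite_image snd (zq I oI)) => y /= nI.
apply: contrapT => ny; apply: nI; apply: topsum_in => //.
  exact: zero_convergent_mulr.
by move=> x; apply: contrapT => nIx; apply: ny; exists (x, y).
Qed.

End SumTheory.

Section Monad.
Variable R : crlTopRingType.

Record formal_sum (X : Type) := FormalSum {
  coef :> X -> R ;
  coef_zc : zero_convergent coef }.

Lemma formal_sumP X (s t : formal_sum X) : s =1 t -> s = t.
Proof.
case: s t => [s zs] [t zt] /= /funext st; case: _ / st in zt *.
by congr FormalSum; exact: Prop_irrelevance.
Qed.

Definition fs_map X Y (f : X -> Y) (t : formal_sum X) : formal_sum Y :=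
  FormalSum (zero_convergent_push f (@coef_zc _ t)).

Lemma delta_zc X (x : X) :
  zero_convergent (fun y => if `[< x = y >] then 1 : R else 0).
Proof.
apply: (@topsum_single _ _ _ x _).1 => y yx.
by rewrite asboolF// => /esym.
Qed.

Definition fs_unit X (x : X) : formal_sum X := FormalSum (delta_zc x).

Definition fs_mul X (T : formal_sum (formal_sum X)) : formal_sum X :=
  FormalSum (zero_convergent_comb_sum (@coef_zc _ T) (fun t => @coef_zc X t)).

Lemma zero_zc X : zero_convergent (fun _ : X => 0 : R).
Proof.
move=> I oI; apply: (@sub_finite_set _ _ set0) => // x /= nI.
by apply: nI; exact: ori0.
Qed.

Lemma add_zc X (s t : X -> R) : zero_convergent s -> zero_convergent t ->
  zero_convergent (fun x => s x + t x).
Proof.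
move=> zs zt I oI.
apply: (@sub_finite_set _ _ ([set x | ~ I (s x)] `|` [set x | ~ I (t x)])).
  move=> x /= nI; apply: contrapT => /not_orP[/contrapT Is /contrapT It].
  by apply: nI; exact: oriD.
by rewrite finite_setU; split; [exact: zs|exact: zt].
Qed.

Definition fs_zero X : formal_sum X := FormalSum (@zero_zc X).
Definition fs_add X (s t : formal_sum X) : formal_sum X :=
  FormalSum (add_zc (@coef_zc _ s) (@coef_zc _ t)).

Lemma topsum_fs_map X Y (f : X -> Y) (t : formal_sum X) (g : Y -> R) :
  topsum (fun y => fs_map f t y * g y) = topsum (fun x => t x * g (f x)).
Proof.
have zt := @coef_zc _ t.
have zg := zero_convergent_mulr (fun x => g (f x)) zt.
rewrite -(topsum_push f zg); congr topsum; apply/funext => y /=.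
rewrite -topsum_mulr; last exact: zero_convergent_fiber.
congr topsum; apply/funext => x; rewrite /fiber_part.
by case: asboolP => [->|_] //; rewrite mul0r.
Qed.

Lemma topsum_fs_mul X (T : formal_sum (formal_sum X)) (g : X -> R) :
  topsum (fun x => fs_mul T x * g x)
  = topsum (fun t => T t * topsum (fun x => t x * g x)).
Proof.
have zT := @coef_zc _ T; have zs t := zero_convergent_mulr g (@coef_zc X t).
have [E1 E2] := topsum_pair (zero_convergent_comb zT zs).
transitivity (topsum (fun x => topsum (fun t : formal_sum X => T t * (t x * g x)))).
  congr topsum; apply/funext => x /=; rewrite -topsum_mulr.
    by congr topsum; apply/funext => t; rewrite mulrA.
  exact: zero_convergent_mulr.
rewrite E2 -E1; congr topsum; apply/funext => t /=.
by rewrite topsum_mull.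
Qed.

Lemma fiber_partE X Y (f : X -> Y) (r : X -> R) y :
  fiber_part f r y = fun x => r x * (if `[< f x = y >] then 1 else 0).
Proof.
by apply/funext => x; rewrite /fiber_part; case: ifP; rewrite ?mulr1 ?mulr0.
Qed.

Lemma fs_map_comp X Y Z (f : X -> Y) (g : Y -> Z) t :
  fs_map g (fs_map f t) = fs_map (g \o f) t.
Proof. by apply: formal_sumP => z /=; rewrite !fiber_partE topsum_fs_map. Qed.

Lemma fs_map_unit X Y (f : X -> Y) x : fs_map f (fs_unit x) = fs_unit (f x).
Proof.
apply: formal_sumP => y /=.
have [|_ ->] := @topsum_single _ _ (fiber_part f (fs_unit x) y) x.
  by move=> x' x'x; rewrite /fiber_part/=; case: ifP => // _; rewrite asboolF// => /esym.
by rewrite /fiber_part/= (asboolT (erefl x)).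
Qed.

Lemma fs_mul_nat X Y (f : X -> Y) T :
  fs_mul (fs_map (fs_map f) T) = fs_map f (fs_mul T).
Proof.
apply: formal_sumP => y.
rewrite [LHS](topsum_fs_map (fs_map f) T (fun t => t y)) /= !fiber_partE.
rewrite (topsum_fs_mul T (fun x => if `[< f x = y >] then 1 else 0)).
by congr topsum; apply/funext => t /=; rewrite fiber_partE.
Qed.

End Monad.

Record contramodule (R : crlTopRingType) := Contramodule {
  carrier :> Type ;
  contraaction : formal_sum R carrier -> carrier ;
  contra_assoc : forall T : formal_sum R (formal_sum R carrier),
    contraaction (fs_map contraaction T) = contraaction (fs_mul T) ;
  contra_unit : forall c : carrier, contraaction (fs_unit R c) = c }.

Record contra_hom (R : crlTopRingType) (C D : contramodule R) := ContraHom {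
  hom_fun :> C -> D ;
  hom_contra : forall t : formal_sum R C,
    hom_fun (contraaction t) = contraaction (fs_map hom_fun t) }.

Section Contramodules.
Variable R : crlTopRingType.
Implicit Types C D P S : contramodule R.

Definition contra_zero C : C := contraaction (fs_zero R C).
Definition contra_add C (a b : C) : C :=
  contraaction (fs_add (fs_unit R a) (fs_unit R b)).

Definition isomorphic C D : Prop :=
  exists (f : contra_hom C D) (g : contra_hom D C), cancel f g /\ cancel g f.

Definition epi C D (f : contra_hom C D) : Prop :=
  forall (E : contramodule R) (g h : contra_hom D E),
    (forall c, g (f c) = h (f c)) -> forall d, g d = h d.

Definition projective P : Prop :=
  forall (C D : contramodule R) (p : contra_hom C D) (f : contra_hom P D),
    epi p -> exists g : contra_hom P C, forall x, p (g x) = f x.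

Definition is_coproduct (X : Type) (F : X -> contramodule R) C
    (inj : forall x, contra_hom (F x) C) : Prop :=
  forall (D : contramodule R) (g : forall x, contra_hom (F x) D),
    (exists h : contra_hom C D, forall x c, h (inj x c) = g x c) /\
    (forall h h' : contra_hom C D,
       (forall x c, h (inj x c) = g x c) -> (forall x c, h' (inj x c) = g x c) ->
       forall c, h c = h' c).

Definition subcontramodule C (A : set C) : Prop :=
  forall t : formal_sum R {c : C | A c}, A (contraaction (fs_map sval t)).

Definition simple S : Prop :=
  (exists s : S, s <> contra_zero S) /\
  forall A : set S, subcontramodule A -> A = [set contra_zero S] \/ A = setT.

Definition contra_ker C D (f : contra_hom C D) : set C :=
  [set c | f c = contra_zero D].

Definition superfluous C (K : set C) : Prop :=
  forall L : set C, subcontramodule L ->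
    (forall c, exists k l, [/\ K k, L l & c = contra_add k l]) -> L = setT.

Definition projective_cover P C (p : contra_hom P C) : Prop :=
  [/\ projective P, epi p & superfluous (contra_ker p)].

Section Sub.
Variables (C : contramodule R) (A : set C) (subA : subcontramodule A).

Definition sub_action (t : formal_sum R {c : C | A c}) : {c : C | A c} :=
  exist _ (contraaction (fs_map sval t)) (subA t).

Lemma sub_assoc T : sub_action (fs_map sub_action T) = sub_action (fs_mul T).
Proof.
apply: eq_exist => /=; rewrite fs_map_comp -fs_mul_nat -contra_assoc.
by rewrite fs_map_comp.
Qed.

Lemma sub_unit c : sub_action (fs_unit R c) = c.
Proof.
case: c => c Ac; apply: eq_exist => /=.
by rewrite fs_map_unit contra_unit.
Qed.

Definition sub_contra : contramodule R := Contramodule sub_assoc sub_unit.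
End Sub.

Definition regular_action (t : formal_sum R R) : R := topsum (fun c => t c * c).

Lemma regular_assoc T :
  regular_action (fs_map regular_action T) = regular_action (fs_mul T).
Proof.
by rewrite /regular_action (topsum_fs_map _ _ id) (topsum_fs_mul _ id).
Qed.

Lemma regular_unit c : regular_action (fs_unit R c) = c.
Proof.
rewrite /regular_action.
have [|_ ->] := @topsum_single _ _ (fun d => fs_unit R c d * d) c.
  by move=> d dc; rewrite /= asboolF ?mul0r// => /esym.
by rewrite /= asboolT// mul1r.
Qed.

Definition regular_contra : contramodule R :=
  Contramodule regular_assoc regular_unit.

Lemma left_ideal_sub (e : R) :
  subcontramodule (C := regular_contra) [set x : R | exists y, x = y * e].
Proof.
move=> t /=.
have [y yE] := @choice _ _
  (fun (c : {c : R | exists y, c = y * e}) y => sval c = y * e) svalP.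
exists (topsum (fun c => t c * y c)).
rewrite [LHS](topsum_fs_map _ _ id) -topsum_mulr.
  by congr topsum; apply/funext => c; rewrite /= yE mulrA.
exact/zero_convergent_mulr/coef_zc.
Qed.

Definition left_ideal_contra (e : R) : contramodule R :=
  sub_contra (left_ideal_sub (e := e)).

End Contramodules.

Section Local.
Variable R : crlTopRingType.

(* For idempotent e, [corner e] is the ring e R e, whose unit element is e. *)
Definition corner (e : R) : set R := [set x | exists y, x = e * y * e].

Definition corner_invertible (e x : R) : Prop :=
  exists y, [/\ corner e y, x * y = e & y * x = e].

Definition local_idempotent (e : R) : Prop :=
  let N := [set x | corner e x /\ ~ corner_invertible e x] in
  [/\ e * e = e, e <> 0, N 0 & forall x y, N x -> N y -> N (x - y)].

Definition topologically_semiperfect : Prop :=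
  exists (Z : Type) (e : Z -> R),
    [/\ zero_convergent e, (forall z w, z <> w -> e z * e w = 0),
        topsum e = 1 & forall z, local_idempotent (e z)].

End Local.

(* Main.v *)
Require Import Defs.
From HB Require Import structures.
From mathcomp Require Import all_boot all_order all_algebra finmap.
From mathcomp Require Import boolp classical_sets functions cardinality.
From mathcomp Require Import topology tvs.

Set Implicit Arguments.
Unset Strict Implicit.
Unset Printing Implicit Defensive.

Import GRing.Theory.
Local Open Scope classical_set_scope.
Local Open Scope ring_scope.

(** A projective contramodule [P] is a retract of a free one, that is, the image
    of an idempotent matrix [f] with zero-convergent rows. The core of the proof
    is that every such [f] can be diagonalized: [f = u v], where [v u] is diagonal
    with entries that are zero or among the local idempotents [e z] whose sum
    is [1] ([diagonalize_all]). The rows of [v] then generate summands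
    [R (e z)] of [P], the columns of [u] are the corresponding coordinates, and
    zero-convergence of the rows of [u] makes [P] the coproduct of these summands
    ([coproduct_of_diagonal]).

    The diagonalization follows the theorem of Crawley, Jonsson and Warfield on
    direct summands of direct sums of countably generated modules with local
    endomorphism rings; in place of elements of modules there are right ideals of
    a matrix ring, given by a row index and an open right ideal of [R].
    - Finite sums of orthogonal local idempotents have the exchange property
      ([exchange]). A row of [f] is, up to any open right ideal, concentrated on
      such a finite sum; hence [f] splits as [g + h] where [g] is a finite
      orthogonal sum of local idempotents and the given row of [h] is as small as
      desired ([refine_summand]).
    - If all but countably many rows of [f] vanish, then this can be iterated over
      all rows and a countable base of open right ideals. The remainders tend to
      zero, which diagonalizes [f] ([diagonalize]).
    - In general, the countable base forces the rows of [f] to have countable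
      support, so a set of indices that is closed under [f] can always be enlarged
      by countably many indices to another closed set. As in Kaplansky's theorem
      on direct sums of countably generated modules, Zorn's lemma reduces the
      claim to the countable case, applied to the idempotent that [f] induces
      between two consecutive closed sets ([stage_extension]).

    For a local idempotent [e], the elements of [R e] no multiple of which
    generates [R e] form a subcontramodule that contains all proper
    subcontramodules ([sub_rad], [rad_max]), so that [R e] is a projective cover
    of its simple quotient. The point is closure under infinite sums
    ([nonunit_topsum]). *)

(** * Finite orthogonal sums of local idempotents in a ring *)

Section Exchange.
Variable S : pzRingType.
Implicit Types a b e f l p x y : S.

(** Lets an equation between products rewrite inside longer left-associated
    words. *)
Lemma mulr_suffix a b c : a * b = c -> forall z, z * a * b = z * c.
Proof. by move=> <- z; rewrite mulrA. Qed.

Lemma sub_idem e p : e * e = e -> e * p = p -> p * e = p -> p * p = p ->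
  [/\ (e - p) * (e - p) = e - p, e * (e - p) = e - p & (e - p) * e = e - p].
Proof.
by move=> ee ep pe pp; rewrite !(mulrBl, mulrBr) ee ep pe pp subrr subr0.
Qed.

(** Murray-von Neumann equivalence: the right ideals [a S] and [b S] are
    isomorphic. The normalizations of [x] and [y] in the last two clauses cost
    nothing and make [a] and [b] idempotent. *)
Definition idem_equiv a b : Prop :=
  exists x y, [/\ x * y = a, y * x = b, a * x = x /\ x * b = x
                & b * y = y /\ y * a = y].

Lemma idem_equiv_refl a : a * a = a -> idem_equiv a a.
Proof. by move=> aa; exists a, a. Qed.

Lemma idem_equiv_sym a b : idem_equiv a b -> idem_equiv b a.
Proof. by case=> x [y [xy yx [ax xb] [by_ ya]]]; exists y, x. Qed.

Lemma idem_equivl a b : idem_equiv a b -> a * a = a.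
Proof. by case=> x [y [<- _ [ax _] _]]; rewrite mulrA ax. Qed.

Lemma idem_equiv_trans b a c :
  idem_equiv a b -> idem_equiv b c -> idem_equiv a c.
Proof.
case=> x [y [xy yx [ax xb] [by_ ya]]] [x' [y' [xy' yx' [bx' xc'] [cy' yb']]]].
exists (x * x'), (y' * y); split.
- by rewrite mulrA -(mulrA x) xy' xb.
- by rewrite mulrA -(mulrA y') yx yb'.
- by rewrite mulrA ax -mulrA xc'.
- by rewrite mulrA cy' -mulrA ya.
Qed.

Definition inv_in e x : Prop := exists y, [/\ e * y * e = y, x * y = e & y * x = e].

(** For an idempotent this is locality of the corner ring [e S e], except that
    [0] is allowed; in this form it passes through equivalences. *)
Definition splits e : Prop :=
  forall x, e * x * e = x -> inv_in e x \/ inv_in e (e - x).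

Lemma splits_equiv a b : idem_equiv a b -> splits a -> splits b.
Proof.
case=> x [y [xy yx [ax xb] [by_ ya]]] sa t bt.
pose R := (mulr_suffix xy, mulr_suffix yx, mulr_suffix xb, mulr_suffix ya,
           mulr_suffix ax, mulr_suffix by_, xy, yx, ax, xb, by_, ya).
have key s : b * s * b = s -> inv_in a (x * s * y) -> inv_in b s.
  move=> bs [u [au su us]].
  have sE : s = y * (x * s * y) * x by rewrite !mulrA !R bs.
  exists (y * u * x); split; first by rewrite !mulrA !R.
  - have -> : s * (y * u * x) = y * (x * s * y * (a * u * a)) * x.
      by rewrite {1}sE !mulrA !R.
    by rewrite au su ya.
  - have -> : y * u * x * s = y * ((a * u * a) * (x * s * y)) * x.
      by rewrite {1}sE !mulrA !R.
    by rewrite au us ya.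
have := sa (x * t * y); rewrite !mulrA !R => /(_ erefl).
have -> : a - x * t * y = x * (b - t) * y by rewrite mulrBr mulrBl !R.
have bb : b * b = b by rewrite -{2}yx mulrA by_ yx.
case=> H; [left; exact: key H|right; apply: key H].
by rewrite mulrBr mulrBl bt !bb.
Qed.

Section Dec.
Variable base : set S.

(** [base] is the stock of idempotents out of which others are to be built up to
    equivalence. *)
Definition good l : Prop := splits l /\ exists2 b, base b & idem_equiv l b.

(** [s] lists pairwise orthogonal good idempotents with sum [e]; the recursive
    form, peeling off one term at a time, is the one that inductions use. *)
Fixpoint orth_dec e (s : seq S) : Prop :=
  if s is l :: s' then
    [/\ good l, l * e = l, e * l = l & orth_dec (e - l) s'] else e = 0.

Lemma good_equiv l l' : idem_equiv l' l -> good l -> good l'.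
Proof.
move=> ll [sl [b bb lb]]; split; first by apply: splits_equiv sl; exact: idem_equiv_sym.
by exists b => //; exact: idem_equiv_trans lb.
Qed.

Lemma good_idem l : good l -> l * l = l.
Proof. by case=> _ [b _ /idem_equivl]. Qed.

Lemma orth_dec_equiv s e e' : idem_equiv e e' -> orth_dec e s ->
  exists2 s', size s' = size s & orth_dec e' s'.
Proof.
elim: s e e' => [|l s IH] e e' /=.
  case=> x [y [xy yx [ax xb] [by_ ya]]] e0; exists [::] => //=.
  by rewrite -yx -ya e0 mulr0 mul0r.
case=> x [y [xy yx [ax xb] [by_ ya]]] [gl le el ds].
have ll := good_idem gl.
have ee : e * e = e by rewrite -{1}xy -mulrA ya xy.
pose R := (mulr_suffix xy, mulr_suffix yx, mulr_suffix xb, mulr_suffix ya,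
           mulr_suffix ax, mulr_suffix by_, mulr_suffix le, mulr_suffix el,
           mulr_suffix ll, mulr_suffix ee, xy, yx, ax, xb, by_, ya, le, el, ll, ee).
pose B := (mulrBl, mulrBr).
have [|s' ss' ds'] := IH (e - l) (e' - y * l * x) _ ds.
  exists (x - l * x), (y - y * l).
  by split; [| |split|split]; rewrite ?B ?mulrA ?R ?subrr ?subr0.
exists (y * l * x :: s'); first by rewrite /= ss'.
split=> //; try by rewrite ?mulrA ?R.
apply: good_equiv gl; exists (y * l), (l * x).
by split; [| |split|split]; rewrite ?mulrA ?R.
Qed.


Definition fin_dec e : Prop := exists s, orth_dec e s.

Lemma fin_dec0 : fin_dec 0. Proof. by exists [::]. Qed.

Lemma fin_dec_equiv e e' : idem_equiv e e' -> fin_dec e -> fin_dec e'.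
Proof. by move=> ee' [s /(orth_dec_equiv ee')[s' _ ds']]; exists s'. Qed.

Lemma fin_decD l e : good l -> l * e = 0 -> e * l = 0 ->
  fin_dec e -> fin_dec (l + e).
Proof.
move=> gl le el [s ds]; exists (l :: s); have ll := good_idem gl.
by split; rewrite // ?mulrDr ?mulrDl ?le ?el ?ll ?addr0 // addrC addKr.
Qed.

Lemma orth_dec_idem s e : orth_dec e s -> e * e = e.
Proof.
elim: s e => [|l s IH] e /=; first by move=> ->; rewrite mulr0.
move=> [gl le el /IH]; rewrite !(mulrBl, mulrBr) le el (good_idem gl) subrr subr0.
by move=> /(addIr (- l)).
Qed.

(** The exchange property of finite orthogonal sums of local idempotents. Let
    [l] be the first term of [e]. One of [l a l] and [l b l] is invertible in
    [l S l], by symmetry the former. Then [q = a u], with [u] the inverse, is an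
    idempotent in [a S] equivalent to [l], and its complement [c = e - q] has
    the same right ideal as [e - l], so that the induction hypothesis splits [c]
    as [p' + r] with [p'] in [c a S] and [r] in [c b S]. As [c a S] lies in
    [a S], only [r] is misplaced: it is replaced by its lift [w] in [b S], whose
    complement is again in [a S] because [w = q w + r]. *)
Lemma exchange s e a b : orth_dec e s ->
  e = a + b -> e * a = a -> a * e = a -> e * b = b -> b * e = b ->
  exists p, [/\ p * p = p, e * p = p /\ p * e = p,
    (exists x, p = a * x) /\ (exists y, e - p = b * y),
    fin_dec p & fin_dec (e - p)].
Proof.
move=> ds.
have [n] := ubnP (size s); elim: n => // n IH in s e a b ds *.
rewrite ltnS => sn.
case: s => [|l s] in ds sn *.
  move: ds => /= -> _ a0 _ b0 _; exists 0; rewrite mulr0 subrr; split => //.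
  - by split; exists 0; rewrite mulr0.
  - exact: fin_dec0.
  - exact: fin_dec0.
have [gl le el ds'] := ds.
have ee := orth_dec_idem ds; have ll := good_idem gl.
wlog [u [lu lau ula]] : a b / inv_in l (l * a * l).
  move=> H eab ea ae eb be.
  have [sl _] := gl; have := sl (l * a * l); rewrite !mulrA ll -(mulrA _ l l) ll.
  move=> /(_ erefl)[Ha|Hb]; first exact: (H a b).
  have lbl : l - l * a * l = l * b * l.
    have -> : b = e - a by rewrite eab addrC addKr.
    by rewrite mulrBr mulrBl le ll.
  rewrite lbl in Hb.
  have [||||||p [pp [ep pe] [bp ap] fp fep]] := H b a; rewrite // 1?addrC //.
  have [rr er re] := sub_idem ee ep pe pp.
  by exists (e - p); rewrite subKr.
move=> eab ea ae eb be.
have lu1 : l * u = u by rewrite -lu !mulrA ll.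
have ul1 : u * l = u by rewrite -lu -!mulrA ll.
have eu : e * u = u by rewrite -lu1 mulrA el.
have ue : u * e = u by rewrite -ul1 -mulrA le.
pose q := a * u; pose c := e - q.
have lq : l * q = l.
  by rewrite -{2}lau /q -!mulrA lu1.
have ql : q * l = q by rewrite /q -mulrA ul1.
have qq : q * q = q by rewrite -{1}ql -mulrA lq ql.
have eq : e * q = q by rewrite /q mulrA ea.
have qe : q * e = q by rewrite /q -mulrA ue.
have qc : q * c = 0 by rewrite mulrBr qe qq subrr.
have cq : c * q = 0 by rewrite mulrBl eq qq subrr.
have cc : c * c = c by rewrite {1}/c mulrBl qc subr0 mulrBr ee eq.
have ec : e * c = c by rewrite mulrBr ee eq.
have ce : c * e = c by rewrite mulrBl ee qe.
have [t ts dt] : exists2 t, size t = size s & orth_dec c t.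
  apply: orth_dec_equiv ds'; exists c, (e - l).
  have lc : l * c = 0 by rewrite mulrBr le lq subrr.
  have cl : c * l = l - q by rewrite mulrBl el ql.
  have H1 : (e - l) * c = c by rewrite mulrBl ec lc subr0.
  have H2 : c * (e - l) = e - l by rewrite mulrBr ce cl /c opprB addrA subrK.
  have H3 : (e - l) * (e - l) = e - l.
    by rewrite !(mulrBl, mulrBr) ee el le ll subrr subr0.
  by [].
have tn : (size t < n)%N by rewrite ts.
have [|||||p' [pp' [cp' pc'] [[x' px'] [y' py']] fp' fr]] :=
    IH t c (c * a * c) (c * b * c) dt tn.
- by rewrite -mulrDl -mulrDr -eab ce cc.
- by rewrite !mulrA cc.
- by rewrite -!mulrA cc.
- by rewrite !mulrA cc.
- by rewrite -!mulrA cc.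
set r := c - p' in py' fr.
have [rr cr rc] : [/\ r * r = r, c * r = r & r * c = r] by exact: sub_idem.
pose w := b * (c * y' * r).
have ew : e * w = w by rewrite mulrA eb.
have wr : w * r = w by rewrite /w -!mulrA rr.
have cw : c * w = r by rewrite /w !mulrA -py' rr.
have rw : r * w = r by rewrite -rc -mulrA cw rr.
have ww : w * w = w by rewrite -{1}wr -mulrA rw wr.
have we : w * e = w by rewrite -wr -{1}rc -!mulrA ce rc.
have wE : w = q * w + r by rewrite -cw -mulrDl /c addrC subrK ew.
have eE : e = q + p' + r.
  by rewrite -addrA (addrC p') /r subrK addrC /c subrK.
have [ww' ew' we'] := sub_idem ee ew we ww.
exists (e - w); rewrite subKr; split => //.
- split; last by exists (c * y' * r).
  have -> : e - w = q + p' - q * w.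
    by rewrite [in LHS]eE [in LHS]wE opprD addrA addrAC addrK.
  exists (u + c * x' - u * a * c * x' - u * w).
  have -> : p' = a * c * x' - q * a * c * x'.
    by rewrite px' {1}/c !mulrBl ea.
  by rewrite (mulrBr a) (mulrBr a) (mulrDr a u) /q !mulrA addrA.
- apply: (@fin_dec_equiv (q + p')); last first.
    apply: fin_decD fp'.
    + by apply: good_equiv gl; exists q, l.
    + by rewrite -cp' mulrA qc mul0r.
    + by rewrite -pc' -mulrA cq mulr0.
  have -> : q + p' = e - r by rewrite [in RHS]eE addrK.
  have er : e * r = r by rewrite -cr mulrA ec.
  have re : r * e = r by rewrite -rc -mulrA ce.
  exists (e - w), (e - r).
  clearbody r w.
  by split; [| |split|split]; rewrite !(mulrBl, mulrBr)
    ?ee ?ew ?we ?er ?re ?wr ?rw ?rr ?ww ?subrr ?subr0.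
- apply: fin_dec_equiv fr; exists r, w.
  by [].
Qed.

(** In the right module [S / J], the class [xi] of [f] is fixed by [f], and the
    last hypothesis says that [e] fixes it too. The conclusion is that a finite
    sum [g] of local summands of [f] already fixes it. Indeed [e f e] fixes [xi],
    and [exchange] yields an idempotent [p] in [e f e S] with [e - p] in
    [(e - e f e) S]; the latter kills [xi], hence [p] fixes [xi]. As [p] begins
    with [e f], it is equivalent to an idempotent below [f]. *)
Lemma refine_summand (J : set S) f e : f * f = f -> fin_dec e ->
  (forall x y, J x -> J y -> J (x - y)) -> (forall x r, J x -> J (x * r)) ->
  J (f - f * e) ->
  exists g, [/\ fin_dec g, f * g = g, g * f = g & J (f - g)].
Proof.
move=> ff [s ds] JB JM Jfe.
have JN x y : J (x - y) -> J (y - x).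
  by move=> Jxy; rewrite -opprB -mulrN1; exact: JM.
have Jtr y x z : J (x - y) -> J (y - z) -> J (x - z).
  move=> Jxy Jyz; have -> : x - z = (x - y) - (z - y) by rewrite opprB addrA subrK.
  by apply: JB => //; exact: JN.
have JMr r x y : J (x - y) -> J (x * r - y * r) by rewrite -mulrBl; exact: JM.
have ee := orth_dec_idem ds.
have [|||||p [pp [ep pe] [[x px] [y py]] fp _]] :=
    @exchange s e (e * f * e) (e - e * f * e) ds.
- by rewrite addrC subrK.
- by rewrite !mulrA ee.
- by rewrite -mulrA ee.
- by rewrite mulrBr !mulrA ee.
- by rewrite mulrBl -!mulrA ee.
(* After this normalization of x, both products p f and f e x p carry the
   idempotent p on the appropriate side. *)
have {}px : p = e * f * e * (x * p) by rewrite mulrA -px pp.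
exists (f * e * x * p * f); split.
- apply: fin_dec_equiv fp; exists (p * f), (f * e * x * p).
  have pfx : p * f * e * x * p = p.
    by move: (pp); rewrite {2}px !mulrA pe.
  have pfxz z : z * p * f * e * x * p = z * p by rewrite -[in RHS]pfx !mulrA.
  pose R := (mulr_suffix ff, mulr_suffix pp, ff, pp, pfx, pfxz).
  by split; [| |split|split]; rewrite ?mulrA ?R.
- by rewrite !mulrA ff.
- by rewrite -mulrA ff.
- have Jf : J (f - f * p).
    apply: (Jtr (f * e)) => //.
    have -> : f * e - f * p = (f - f * e) * (f * e * y).
      by rewrite -mulrBr py mulrBl mulrBr mulrBl !mulrA ff.
    exact: JM.
  apply: (Jtr (f * p * f)); first by rewrite -{1}ff -mulrBl; exact: JM.
  rewrite -mulrBl; apply: (JM); apply: (JN).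
  have -> : f * e * x * p - f * p = (f - f * e) * (f * e * x * p).
    by rewrite mulrBl {2}px !mulrA ff.
  exact: JM.
Qed.

Lemma orth_dec_sum s e : orth_dec e s -> e = \sum_(l <- s) l.
Proof.
elim: s e => [|l s IH] e /=; first by rewrite big_nil.
by rewrite big_cons => -[_ _ _ /IH <-]; rewrite addrC subrK.
Qed.

Lemma orth_dec_nth s e i : orth_dec e s -> (i < size s)%N ->
  [/\ good s`_i, s`_i * e = s`_i & e * s`_i = s`_i].
Proof.
elim: s e i => [|l s IH] e [|i] //= [gl le el ds]; first by [].
rewrite ltnS => /(IH _ _ ds)[gi ie ei]; have ll := good_idem gl.
have li : l * s`_i = 0 by rewrite -ei mulrA mulrBr le ll subrr mul0r.
have il : s`_i * l = 0 by rewrite -ie -mulrA mulrBl el ll subrr mulr0.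
split=> //; first by rewrite -{2}ie mulrBr il subr0.
by rewrite -{2}ei mulrBl li subr0.
Qed.

Lemma orth_dec_orth s e i j : orth_dec e s -> (i < size s)%N -> (j < size s)%N ->
  i <> j -> s`_i * s`_j = 0.
Proof.
elim: s e i j => [|l s IH] e [|i] [|j] //= [gl le el ds]; rewrite ?ltnS => ilt jlt ij.
- have [_ _ ei] := orth_dec_nth ds jlt.
  by rewrite -ei mulrA mulrBr le good_idem // subrr mul0r.
- have [_ ie _] := orth_dec_nth ds ilt.
  by rewrite -ie -mulrA mulrBl el good_idem // subrr mulr0.
- by apply: IH ds _ _ _ => // eij; apply: ij; rewrite eij.
Qed.

End Dec.
End Exchange.

(** * Row-zero-convergent matrices *)

Section MoreSums.
Variable R : crlTopRingType.

Lemma topsum_eq (X : Type) (r : X -> R) (s : R) : zero_convergent r ->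
  (forall I, open_right_ideal I -> exists A : {fset {classic X}},
     (forall x : {classic X}, x \notin A -> I (r x)) /\
     I (s - \sum_(x <- A) r x)) ->
  topsum r = s.
Proof.
move=> zr H; apply: ori_sep => I oI; have [A [rA sA]] := H I oI.
apply: (ori_trans oI (topsum_approx zr oI rA)); exact: (oriBC oI).
Qed.

Lemma topsumD X (r s : X -> R) : zero_convergent r -> zero_convergent s ->
  topsum (fun x => r x + s x) = topsum r + topsum s.
Proof.
move=> zr zs; apply: topsum_eq; first exact: add_zc.
move=> I oI; exists (bad I r `|` bad I s)%fset.
have rI x : x \notin (bad I r `|` bad I s)%fset -> I (r x) /\ I (s x).
  by rewrite inE => /norP[/(badP zr oI) ? /(badP zs oI)].
split; first by move=> x /rI[]; exact: (oriD oI).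
rewrite big_split/= opprD addrACA; apply: (oriD oI).
  by apply: topsum_approx => // x /rI[].
by apply: topsum_approx => // x /rI[].
Qed.

Lemma topsum0 X : topsum (fun _ : X => 0 : R) = 0.
Proof.
apply: topsum_eq; first exact: zero_zc.
by move=> I oI; exists fset0; rewrite big1 ?subrr //; split => *; exact: (ori0 oI).
Qed.

Lemma opp_zc X (s : X -> R) : zero_convergent s -> zero_convergent (fun x => - s x).
Proof. by move=> zs; apply: zero_convergent_sub zs _ => I x oI; exact: (oriN oI). Qed.

Lemma topsum_one X (r : X -> R) x0 : (forall x, x <> x0 -> r x = 0) ->
  topsum r = r x0.
Proof. by move=> H; have [] := @topsum_single R X r x0 H. Qed.

Lemma countable_ideal_base : countable_base_at_zero R ->
  exists I : nat -> set R, (forall n, open_right_ideal (I n)) /\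
    forall J, open_right_ideal J -> exists n, I n `<=` J.
Proof.
case=> B [/countable_injP[i iinj] Bo Bb].
have Tn : open_right_ideal (@setT R) by split=> //; exact: openT.
have H n : exists I, open_right_ideal I /\ forall U, B U -> i U = n -> I `<=` U.
  have [[U [BU iU]]|nU] := pselect (exists U, B U /\ i U = n); last first.
    by exists setT; split=> // U BU iU; case: nU; exists U.
  have [I oI IU] := @right_linear R _ (open_nbhs_nbhs (Bo _ BU)).
  exists I; split=> // V BV iV; suff -> : V = U by [].
  by apply: iinj; rewrite ?inE // iU.
have [I HI] := choice H; exists I; split; first by move=> n; have [] := HI n.
move=> J oJ; have [|U BU UJ] := Bb J.
  by apply: open_nbhs_nbhs; split; [case: oJ|exact: (ori0 oJ)].
by exists (i U); apply: subset_trans UJ; have [_] := HI (i U); apply.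
Qed.

(** A countable base of open right ideals has zero intersection, and each member
    of it misses only finitely many terms. *)
Lemma countable_support X (r : X -> R) : countable_base_at_zero R ->
  zero_convergent r -> countable [set x | r x <> 0].
Proof.
move=> /countable_ideal_base[I [oI IJ]] zr.
apply: (@sub_countable _ _ _ (\bigcup_n [set x | ~ I n (r x)])); last first.
  by apply: bigcup_countable => // n _; apply: finite_set_countable; exact: zr.
apply: subset_card_le => x /= rx; apply: contrapT => nx; apply: rx.
apply: ori_sep => J oJ; rewrite subr0; have [n] := IJ J oJ; apply.
by apply: contrapT => nI; apply: nx; exists n.
Qed.

End MoreSums.

(** The endomorphisms of the free contramodule on [W]; a row is the image of a
    generator, and the composite of endomorphisms is the product in the opposite
    order. *)
Definition mat (R : crlTopRingType) (W : Type) : Type := W -> formal_sum R W.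

Section MatrixRing.
Variables (R : crlTopRingType) (W : Type).
Implicit Types a b c : mat R W.

Lemma matP a b : (forall x y, a x y = b x y) -> a = b.
Proof. by move=> ab; apply/funext => x; apply: formal_sumP => y. Qed.

Definition mat_opp a : mat R W :=
  fun x => FormalSum (opp_zc (@coef_zc _ _ (a x))).
Definition mat_mul a b : mat R W := fun x =>
  FormalSum (zero_convergent_comb_sum (@coef_zc _ _ (a x)) (fun y => @coef_zc _ _ (b y))).

Lemma row_zc (s : formal_sum R W) (g : W -> R) : zero_convergent (fun w => s w * g w).
Proof. exact/zero_convergent_mulr/coef_zc. Qed.

HB.instance Definition _ := gen_eqMixin (mat R W).
HB.instance Definition _ := gen_choiceMixin (mat R W).

Definition mat_add a b : mat R W := fun x => fs_add (a x) (b x).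
Definition mat_zero : mat R W := fun=> fs_zero R W.

Fact mat_addA : associative mat_add.
Proof. by move=> a b c; apply: matP => x y /=; rewrite addrA. Qed.
Fact mat_addC : commutative mat_add.
Proof. by move=> a b; apply: matP => x y /=; rewrite addrC. Qed.
Fact mat_add0 : left_id mat_zero mat_add.
Proof. by move=> a; apply: matP => x y /=; rewrite add0r. Qed.
Fact mat_addN : left_inverse mat_zero mat_opp mat_add.
Proof. by move=> a; apply: matP => x y /=; rewrite addNr. Qed.

HB.instance Definition _ :=
  GRing.isZmodule.Build (mat R W) mat_addA mat_addC mat_add0 mat_addN.

Lemma matDE a b x y : (a + b) x y = a x y + b x y. Proof. by []. Qed.
Lemma matNE a x y : (- a) x y = - a x y. Proof. by []. Qed.

Fact mat_mulA : associative mat_mul.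
Proof.
move=> a b c; apply: matP => x y /=.
have [E1 E2] := topsum_pair (zero_convergent_comb (@coef_zc _ _ (a x))
  (fun k => row_zc (b k) (fun l => c l y))).
transitivity (topsum (fun k => topsum (fun l => a x k * (b k l * c l y)))).
  by congr topsum; apply/funext => k; rewrite topsum_mull //; exact: row_zc.
rewrite E1 -E2; congr topsum; apply/funext => l /=.
rewrite -topsum_mulr; last exact: row_zc.
by congr topsum; apply/funext => k; rewrite mulrA.
Qed.

Fact mat_mul1 : left_id (@fs_unit R W) mat_mul.
Proof.
move=> a; apply: matP => x y /=; rewrite (topsum_one (x0 := x)) /=.
  by rewrite asboolT // mul1r.
by move=> z zx; rewrite asboolF ?mul0r // => /esym.
Qed.

Fact mat_mulr1 : right_id (@fs_unit R W) mat_mul.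
Proof.
move=> a; apply: matP => x y /=; rewrite (topsum_one (x0 := y)) /=.
  by rewrite asboolT // mulr1.
by move=> z zy; rewrite asboolF ?mulr0.
Qed.

Fact mat_mulDl : left_distributive mat_mul +%R.
Proof.
move=> a b c; apply: matP => x y; rewrite matDE /=.
rewrite -topsumD; [|exact: row_zc..].
by congr topsum; apply/funext => z; rewrite mulrDl.
Qed.

Fact mat_mulDr : right_distributive mat_mul +%R.
Proof.
move=> a b c; apply: matP => x y; rewrite matDE /=.
rewrite -topsumD; [|exact: row_zc..].
by congr topsum; apply/funext => z; rewrite mulrDr.
Qed.

HB.instance Definition _ := GRing.Zmodule_isPzRing.Build (mat R W)
  mat_mulA mat_mul1 mat_mulr1 mat_mulDl mat_mulDr.

Lemma matME a b x y : (a * b) x y = topsum (fun k => a x k * b k y).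
Proof. by []. Qed.

Lemma mat_mul_row0 a b x y : (forall k, a x k = 0) -> (a * b) x y = 0.
Proof.
move=> a0; rewrite matME -[RHS](topsum0 R W); congr topsum.
by apply/funext => k; rewrite a0 mul0r.
Qed.

Lemma mat_mul_col0 a b x y : (forall k, b k y = 0) -> (a * b) x y = 0.
Proof.
move=> b0; rewrite matME -[RHS](topsum0 R W); congr topsum.
by apply/funext => k; rewrite b0 mulr0.
Qed.

Lemma mat_sumE (T : Type) (s : seq T) (F : T -> mat R W) x y :
  (\sum_(i <- s) F i) x y = \sum_(i <- s) F i x y.
Proof. by elim: s => [|i s IH]; rewrite ?big_nil ?big_cons // matDE IH. Qed.

Lemma diag_zc (d : W -> R) x : zero_convergent (fun y => if `[< x = y >] then d x else 0).
Proof. by apply: (@topsum_single _ _ _ x _).1 => y yx; rewrite asboolF // => /esym. Qed.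

Definition diag (d : W -> R) : mat R W := fun x => FormalSum (diag_zc d x).

Lemma diag_mul d a x y : (diag d * a) x y = d x * a x y.
Proof.
rewrite matME (topsum_one (x0 := x)) /=; first by rewrite asboolT.
by move=> z zx; rewrite asboolF ?mul0r // => /esym.
Qed.

Lemma mul_diag d a x y : (a * diag d) x y = a x y * d y.
Proof.
rewrite matME (topsum_one (x0 := y)) /=; first by rewrite asboolT.
by move=> z zy; rewrite asboolF ?mulr0.
Qed.

Lemma diag_diag d d' : diag d * diag d' = diag (fun x => d x * d' x).
Proof.
by apply: matP => x y; rewrite diag_mul /=; case: asboolP => // _; rewrite mulr0.
Qed.

Lemma diagE d x y : diag d x y = if `[< x = y >] then d x else 0.
Proof. by []. Qed.

Definition proj (A : set W) : mat R W := diag (fun x => if `[< A x >] then 1 else 0).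

Lemma proj_mul A a x y : (proj A * a) x y = if `[< A x >] then a x y else 0.
Proof. by rewrite diag_mul; case: asboolP; rewrite ?mul1r ?mul0r. Qed.
Lemma mul_proj A a x y : (a * proj A) x y = if `[< A y >] then a x y else 0.
Proof. by rewrite mul_diag; case: asboolP; rewrite ?mulr1 ?mulr0. Qed.

Lemma projI A B : proj A * proj B = proj (A `&` B).
Proof.
rewrite diag_diag; congr diag; apply/funext => x; rewrite /setI/= asbool_and.
by case: asboolP; rewrite ?mul1r ?mul0r.
Qed.

Lemma projC A B : proj A * proj B = proj B * proj A.
Proof. by rewrite !projI setIC. Qed.

Lemma projD A B : A `&` B = set0 -> proj (A `|` B) = proj A + proj B.
Proof.
move=> AB0; apply: matP => x y; rewrite matDE !diagE /setU/= asbool_or.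
case: ifP => _; last by rewrite addr0.
case: asboolP => [Ax|_] /=; last by rewrite add0r.
rewrite asboolF ?addr0 // => Bx.
by have : (A `&` B) x; [|rewrite AB0].
Qed.

Lemma proj0 : proj set0 = 0.
Proof. by apply: matP => x y; rewrite diagE (@asboolF (set0 x)) // if_same. Qed.
Lemma projT : proj setT = 1.
Proof. by apply: matP => x y; rewrite diagE (@asboolT (setT x)). Qed.

End MatrixRing.

(** * Diagonalizing an idempotent matrix with countable support *)

Lemma topsum_eq_seq (R : crlTopRingType) (X : Type) (r : X -> R) (s : R) :
  zero_convergent r ->
  (forall I, open_right_ideal I -> exists L : seq {classic X},
     [/\ uniq L, forall x : {classic X}, x \notin L -> I (r x)
       & I (s - \sum_(x <- L) r x)]) ->
  topsum r = s.
Proof.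
move=> zr H; apply: topsum_eq => // I oI; have [L [uL rL sL]] := H I oI.
exists [fset x in L]%fset; split; first by move=> x; rewrite !inE => /rL.
rewrite (perm_big L) //; apply: uniq_perm => [|//|x]; first exact: fset_uniq.
by rewrite !inE.
Qed.

Lemma local_splits (R : crlTopRingType) (d : R) : local_idempotent d -> splits d.
Proof.
case=> dd d0 [_ N0] NB x dx.
have cx : corner d x by exists x; rewrite dx.
have cdx : corner d (d - x) by exists (d - x); rewrite mulrBr mulrBl dd dx dd.
have inv y : corner_invertible d y -> inv_in d y.
  by case=> z [[t zE] yz zy]; exists z; split=> //; rewrite zE !mulrA dd -mulrA dd.
have [/inv|nx] := pselect (corner_invertible d x); first by left.
have [/inv|ndx] := pselect (corner_invertible d (d - x)); first by right.
have := NB _ _ (conj cx nx) (NB _ _ (conj _ N0) (conj cdx ndx)).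
case; first by exists 0; rewrite mulr0 mul0r.
rewrite sub0r opprK addrC subrK => _ [].
by exists d; split => //; exists d; rewrite dd dd.
Qed.

Section Points.
Variables (R : crlTopRingType) (W : Type).
Implicit Types (a b : mat R W) (d : R) (w : W).

Definition pt w d : mat R W := diag (fun x => if `[< x = w >] then d else 0).

Lemma ptE w d : pt w d w w = d.
Proof. by rewrite diagE !asboolT. Qed.

Lemma pt_mul w d a x y : (pt w d * a) x y = if `[< x = w >] then d * a x y else 0.
Proof. by rewrite diag_mul; case: asboolP; rewrite ?mul0r. Qed.

Lemma mul_pt w d a x y : (a * pt w d) x y = if `[< y = w >] then a x y * d else 0.
Proof. by rewrite mul_diag; case: asboolP; rewrite ?mulr0. Qed.

Lemma pt_pt w d d' : pt w d * pt w d' = pt w (d * d').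
Proof.
by rewrite diag_diag; congr diag; apply/funext => x; case: asboolP; rewrite ?mulr0.
Qed.

Lemma pt_sub w d d' : pt w d - pt w d' = pt w (d - d').
Proof.
apply: matP => x y; rewrite matDE matNE !diagE.
by case: ifP => _; [case: ifP|]; rewrite ?subr0.
Qed.

Lemma splits_pt w d : splits d -> splits (pt w d).
Proof.
move=> sd x xE.
have xij i j : (if `[< j = w >] then (if `[< i = w >] then d * x i j else 0) * d else 0)
    = x i j by rewrite -pt_mul -mul_pt xE.
have dxd : d * x w w * d = x w w by have := xij w w; rewrite !asboolT.
have {}xE : x = pt w (x w w).
  apply: matP => i j; rewrite diagE -xij.
  case: (asboolP (i = w)) => [->|_]; case: (asboolP (j = w)) => [->|jw];
    rewrite ?mul0r ?if_same //; first by rewrite asboolT ?dxd.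
  by rewrite asboolF // => /esym.
have inv c : inv_in d c -> inv_in (pt w d) (pt w c).
  by case=> y [dy cy yc]; exists (pt w y); rewrite !pt_pt dy cy yc.
by case: (sd _ dxd) => /inv; rewrite -?pt_sub -xE; [left|right].
Qed.

End Points.

Section Semiperfect.
Variables (R : crlTopRingType) (W Z : Type) (e : Z -> R).
Hypotheses (e_zc : zero_convergent e) (e_orth : forall z z', z <> z' -> e z * e z' = 0)
  (e_sum : topsum e = 1) (e_local : forall z, local_idempotent (e z)).

Definition points : set (mat R W) := [set b | exists w z, b = pt w (e z)].

Lemma e_idem z : e z * e z = e z. Proof. by case: (e_local z). Qed.

Lemma good_pt w z : good points (pt w (e z)).
Proof.
split; first exact/splits_pt/local_splits.
by exists (pt w (e z)); [exists w, z|apply: idem_equiv_refl; rewrite pt_pt e_idem].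
Qed.

Lemma pt_orth (w w' : W) (z z' : Z) : (w, z) <> (w', z') -> pt w (e z) * pt w' (e z') = 0.
Proof.
move=> ne; rewrite diag_diag; apply: matP => x y; rewrite diagE.
case: ifP => // _; case: asboolP => [xw|_]; last by rewrite mul0r.
case: asboolP => [xw'|_]; last by rewrite mulr0.
by rewrite e_orth // => zz'; apply: ne; rewrite -xw xw' zz'.
Qed.

Lemma fin_dec_points (s : seq ({classic W} * {classic Z})) : uniq s ->
  fin_dec points (\sum_(p <- s) pt p.1 (e p.2)).
Proof.
elim: s => [|[w z] s IH] /=; first by rewrite big_nil => _; exact: fin_dec0.
move=> /andP[ns us]; rewrite big_cons; apply: fin_decD (IH us).
- exact: good_pt.
- rewrite mulr_sumr big_seq big1 // => -[w' z'] ps; apply: pt_orth => ww'.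
  by rewrite ww' ps in ns.
- rewrite mulr_suml big_seq big1 // => -[w' z'] ps; apply: pt_orth => ww'.
  by rewrite -ww' ps in ns.
Qed.

Definition row_in (x : W) (I : set R) : set (mat R W) := [set a | forall y, I (a x y)].

Lemma row_inB x I (a b : mat R W) : open_right_ideal I ->
  row_in x I a -> row_in x I b -> row_in x I (a - b).
Proof. by move=> oI Ia Ib y; rewrite matDE matNE; exact: (oriB oI). Qed.

Lemma row_inM x I (a b : mat R W) : open_right_ideal I ->
  row_in x I a -> row_in x I (a * b).
Proof.
move=> oI Ia y; rewrite matME; apply: topsum_in => //; first exact: row_zc.
by move=> k; exact: (oriM oI).
Qed.

(** A row of a matrix is approximated by its products with finite sums of the
    point idempotents, because these sum up to the identity matrix. *)
Lemma row_approx (f : mat R W) x I : open_right_ideal I ->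
  exists2 p, fin_dec points p & row_in x I (f - f * p).
Proof.
move=> oI.
have zp : zero_convergent (fun p : {classic W} * {classic Z} => f x p.1 * e p.2).
  exact: (zero_convergent_comb (@coef_zc _ _ (f x)) (fun _ : W => e_zc)).
pose F := fset_set ([set p | ~ I (f x p.1 * e p.2)] : set ({classic W} * {classic Z})).
have FP (p : {classic W} * {classic Z}) : p \notin F -> I (f x p.1 * e p.2).
  rewrite in_fset_set ?inE; last exact: zp.
  by apply: contraNP => nI; rewrite inE.
exists (\sum_(p <- F) pt p.1 (e p.2)); first exact/fin_dec_points/fset_uniq.
move=> y.
rewrite matDE matNE mulr_sumr mat_sumE.
have zy : zero_convergent (fun z => f x y * e z) by exact: zero_convergent_mull.
have fE : f x y = topsum (fun z => f x y * e z) by rewrite topsum_mull // e_sum mulr1.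
pose Gs : seq {classic Z} := [seq p.2 | p <- F & p.1 == (y : {classic W})].
pose G := [fset z in Gs]%fset.
have -> : \sum_(p <- F) (f * pt p.1 (e p.2)) x y = \sum_(z <- G) f x y * e z.
  transitivity (\sum_(p <- F | p.1 == (y : {classic W})) f x y * e p.2).
    rewrite [RHS]big_mkcond; apply: eq_bigr => p _; rewrite mul_pt /=.
    have -> : `[< y = p.1 >] = (p.1 == (y : {classic W})).
      by apply/asboolP/eqP => ->.
    by [].
  have FG : perm_eq Gs G.
    apply: uniq_perm; last by move=> z; rewrite !inE.
      rewrite map_inj_in_uniq ?filter_uniq ?fset_uniq // => -[w z] [w' z'].
      by rewrite !mem_filter /= => /andP[/eqP-> _] /andP[/eqP-> _] ->.
    exact: fset_uniq.
  by rewrite -(perm_big _ FG) big_map big_filter.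
rewrite {1}fE; apply: topsum_approx => // z zG; apply: FP (y, z) _.
apply: contra zG => yz; rewrite !inE; apply/mapP; exists (y, z) => //.
by rewrite mem_filter /= eqxx.
Qed.

Lemma row_refine (f : mat R W) x I : f * f = f -> open_right_ideal I ->
  exists s g, orth_dec points g s /\
    [/\ f * g = g, g * f = g & row_in x I (f - g)].
Proof.
move=> ff oI; have [p fp fpI] := row_approx f x oI.
have [||g [[s ds] fg gf gI]] := refine_summand ff fp _ _ fpI.
- by move=> a b; exact: row_inB.
- by move=> a b; exact: row_inM.
by exists s, g.
Qed.

Section Peel.
Variables (f : mat R W) (q : nat -> W * set R).
Hypotheses (ff : f * f = f) (oq : forall k, open_right_ideal (q k).2).

(** [h k] is what remains of [f] before step [k], and [s k] lists the local
    idempotents that step [k] removes. *)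
Lemma peel : exists (h : nat -> mat R W) (s : nat -> seq (mat R W)),
  h 0%N = f /\ forall k,
  [/\ h k * h k = h k, orth_dec points (h k - h k.+1) (s k),
      h k * h k.+1 = h k.+1 /\ h k.+1 * h k = h k.+1
    & row_in (q k).1 (q k).2 (h k.+1)].
Proof.
have step (a : mat R W * nat) : exists bs : mat R W * seq (mat R W), a.1 * a.1 = a.1 ->
    [/\ bs.1 * bs.1 = bs.1, orth_dec points (a.1 - bs.1) bs.2,
      a.1 * bs.1 = bs.1 /\ bs.1 * a.1 = bs.1
    & row_in (q a.2).1 (q a.2).2 bs.1].
  have [aa|na] := pselect (a.1 * a.1 = a.1); last by exists (0, [::]).
  have [s [g [ds [ag ga rg]]]] := row_refine (q a.2).1 aa (oq a.2).
  exists (a.1 - g, s) => _ /=; rewrite subKr.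
  have [] := sub_idem aa ag ga (orth_dec_idem ds).
  by move=> -> -> ->.
have [F FP] := choice step.
pose h := fix h k := if k is k'.+1 then (F (h k', k')).1 else f.
have hh k : h k * h k = h k.
  by elim: k => //= k /(FP (h k, k))[].
exists h, (fun k => (F (h k, k)).2); split=> // k.
by have [? ? ? ?] := FP (h k, k) (hh k).
Qed.
End Peel.

(** [iota] and [kappa] reserve countably many indices of [W], at which the
    diagonal form of a matrix can be placed. *)
Variables (kappa : W -> option (nat * nat)) (iota : nat * nat -> W).
Hypotheses (iotaK : pcancel iota kappa)
  (kappaK : forall w p, kappa w = Some p -> iota p = w).

Definition diagonal_of_locals (d : mat R W) : Prop :=
  (forall x y, x <> y -> d x y = 0) /\
  (forall x, d x x = 0 \/ exists z, d x x = e z).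

(** Peeling along a sequence [q] that is cofinal in all pairs of a row index and
    an open right ideal, zero rows excepted, exhausts [f]: the remainders tend to
    zero, so [f] is the sum of the orthogonal local idempotents [l (k, i)]. Each
    of them is a product of a column, supported at a single index, and a row; the
    columns form [u] and the rows [b]. The rows of [u] are zero-convergent
    because [l (k, i)] lies below the remainder [h k]. *)
Lemma diagonalize (f : mat R W) (q : nat -> W * set R) : f * f = f ->
  (forall k, open_right_ideal (q k).2) ->
  (forall x I, open_right_ideal I -> (forall y, f x y = 0) \/
     exists k, (q k).1 = x /\ (q k).2 `<=` I) ->
  exists u b : mat R W,
    [/\ u * b = f, u * b * u = u /\ b * u * b = b, diagonal_of_locals (b * u),
        forall x w, kappa w = None -> u x w = 0
      & forall w y, kappa w = None -> b w y = 0].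
Proof.
move=> ff oq fq; have [h [s [h0 hs]]] := peel ff oq.
have hle i j : (i <= j)%N -> h i * h j = h j /\ h j * h i = h j.
  move=> /subnKC <-; elim: (j - i)%N => [|n [IH1 IH2]].
    by rewrite addn0; have [->] := hs i.
  rewrite addnS; have [_ _ [H1 H2] _] := hs (i + n)%N.
  by split; [rewrite -H1 mulrA IH1|rewrite -H2 -mulrA IH2].
(* The remainders tend to zero in the topology of row-wise convergence. *)
have tail x I : open_right_ideal I -> exists m, forall k, (m <= k)%N -> row_in x I (h k).
  move=> oI; case: (fq x I oI) => [fx|[m [<- qI]]].
    exists 0%N => k k0; have [+ _] := hle _ _ k0.
    by rewrite h0 => <-; apply: row_inM => // y; rewrite fx; exact: ori0.
  exists m.+1 => k mk; have [<- _] := hle _ _ mk; apply: row_inM => // y.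
  by apply: qI; have [_ _ _] := hs m; apply.
pose l (p : nat * nat) := (s p.1)`_p.2.
have lout p : (size (s p.1) <= p.2)%N -> l p = 0 by exact: nth_default.
have lP p : (p.2 < size (s p.1))%N ->
    [/\ good points (l p), l p * (h p.1 - h p.1.+1) = l p
      & (h p.1 - h p.1.+1) * l p = l p].
  by move=> lt; have [_ ds _ _] := hs p.1; exact: orth_dec_nth ds lt.
have lh p : h p.1 * l p = l p /\ l p * h p.1 = l p.
  have [/lout->|/lP[_ lg gl]] := leqP (size (s p.1)) p.2; first by rewrite mulr0 mul0r.
  have [hh _ [h1 h2] _] := hs p.1.
  by split; [rewrite -gl mulrA mulrBr hh h1|rewrite -lg -mulrA mulrBl hh h2].
have lS p k : (p.1 < k)%N -> h k * l p = 0 /\ l p * h k = 0.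
  move=> pk; have [hh _ [h1 h2] _] := hs p.1.
  have [/lout->|/lP[_ lg gl]] := leqP (size (s p.1)) p.2; first by rewrite mulr0 mul0r.
  have [k1 k2] := hle _ _ pk; have [k3 k4] := hle _ _ (ltnW pk).
  split; first by rewrite -gl mulrA mulrBr k2 k4 subrr mul0r.
  by rewrite -lg -mulrA mulrBl k1 k3 subrr mulr0.
have lf p : f * l p = l p /\ l p * f = l p.
  have [l1 l2] := lh p; have [H1 H2] := hle 0%N p.1 isT.
  by rewrite -h0; split; [rewrite -l1 mulrA H1|rewrite -l2 -mulrA H2].
have ll p p' : p <> p' -> l p * l p' = 0.
  move=> pp'; have [lt|lt|eq1] := ltngtP p.1 p'.1.
  - by have [<- _] := lh p'; have [_ H] := lS _ _ lt; rewrite mulrA H mul0r.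
  - by have [_ <-] := lh p; have [H _] := lS _ _ lt; rewrite -mulrA H mulr0.
  have [/lout->|lt1] := leqP (size (s p.1)) p.2; first by rewrite mul0r.
  have [/lout->|lt2] := leqP (size (s p'.1)) p'.2; first by rewrite mulr0.
  rewrite /l -eq1 in lt2 *; have [_ ds _ _] := hs p.1.
  apply: orth_dec_orth ds _ _ _ => // eq2.
  by apply: pp'; case: p p' eq1 eq2 {lt1 lt2} => ? ? [? ?] /= -> ->.
have FX p : exists t : W * (mat R W * mat R W * R), let: (w, (a, b, d)) := t in
    [/\ a * b = l p, b * a = pt w d, l p * a = a /\ b * l p = b,
        a * pt w d = a /\ pt w d * b = b & d = 0 \/ exists z, d = e z].
  have [/lout->|/lP[[_ [_ [w [z ->]]]]]] := leqP (size (s p.1)) p.2.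
    (* Beyond the end of the list the summand is zero, and any index will do. *)
    exists (iota (0%N, 0%N), (0, 0, 0)); rewrite !mulr0 !mul0r; split=> //; last by left.
    by apply: matP => x y; rewrite diagE !if_same.
  case=> a [b [ab ba [la aw] [wb bl]]] _ _.
  by exists (w, (a, b, e z)); split=> //; right; exists z.
have [F FP] := choice FX.
pose w p := (F p).1; pose a p := (F p).2.1.1; pose b p := (F p).2.1.2.
pose d p := (F p).2.2.
have {}FP p : [/\ a p * b p = l p, b p * a p = pt (w p) (d p),
    l p * a p = a p /\ b p * l p = b p,
    a p * pt (w p) (d p) = a p /\ pt (w p) (d p) * b p = b p
  & d p = 0 \/ exists z, d p = e z].
  by move: (FP p); rewrite /w /a /b /d; case: (F p) => ? [[]].
have aout p x y : y <> w p -> a p x y = 0.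
  have [_ _ _ [<- _] _] := FP p; rewrite mul_pt => yw; by rewrite asboolF.
have ab p x y : a p x (w p) * b p (w p) y = l p x y.
  have [<- _ _ _ _] := FP p; rewrite matME (topsum_one (x0 := w p)) // => k kw.
  by rewrite aout ?mul0r.
have aI p x I : open_right_ideal I -> row_in x I (l p) -> I (a p x (w p)).
  move=> oI lI; have [_ _ [<- _] _ _] := FP p; exact: (row_inM _ oI lI).
(* The column of the summand p is moved from w p to the reserved index iota p. *)
pose u x w' := if kappa w' is Some p then a p x (w p) else 0.
have uI x I : open_right_ideal I -> exists m, forall w',
    (forall p, kappa w' = Some p -> (p.1 < m)%N -> (p.2 < size (s p.1))%N -> False) ->
    I (u x w').
  move=> oI; have [m hm] := tail x I oI; exists m => w' nw'; rewrite /u.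
  case: kappa nw' => [p|_]; last exact: ori0.
  move=> /(_ _ erefl) np; apply: aI => //.
  have [/hm hI|/np{}np] := leqP m p.1.
    by have [<- _] := lh p; exact: row_inM.
  by rewrite lout; [move=> y; exact: ori0|rewrite leqNgt; apply/negP => /np].
pose L m : seq {classic W} := [seq (iota (k, i) : {classic W}) | k <- seq.iota 0 m,
  i <- seq.iota 0 (size (s k))].
have LP m w' p : (w' : {classic W}) \notin L m -> kappa w' = Some p ->
    (p.1 < m)%N -> (p.2 < size (s p.1))%N -> False.
  case: p => k i /= nL /kappaK wE km iS; case/negP: nL.
  by apply/allpairsPdep; exists k, i; rewrite !mem_iota.
have u_zc x : zero_convergent (u x).
  move=> I oI; have [m um] := uI x I oI.
  apply: (@sub_finite_set _ _ [set` L m]) => //= w' /= nI.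
  by apply: contrapT => /negP nL; apply: nI; apply: um => p; exact: LP.
pose U : mat R W := fun x => FormalSum (u_zc x).
pose B : mat R W := fun w' => if kappa w' is Some p then b p (w p) else fs_zero R W.
have UE x p : U x (iota p) = a p x (w p) by rewrite /= /u iotaK.
have BE p y : B (iota p) y = b p (w p) y by rewrite /B iotaK.
have Uout x w' : kappa w' = None -> U x w' = 0 by move=> /= kw; rewrite /u kw.
have Bout w' y : kappa w' = None -> B w' y = 0 by move=> kw; rewrite /B kw.
have colE (c : mat R W) x p : (c * U) x (iota p) = (c * a p) x (w p).
  by rewrite !matME; congr topsum; apply/funext => k; rewrite UE.
have rowE (c : mat R W) p y : (B * c) (iota p) y = (b p * c) (w p) y.
  by rewrite !matME; congr topsum; apply/funext => k; rewrite BE.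
have UB : U * B = f.
  apply: matP => x y; rewrite matME; apply: topsum_eq_seq; first exact: row_zc.
  move=> I oI; have [m um] := uI x I oI; have [m' hm'] := tail x I oI.
  exists (L (maxn m m')); split.
  - apply: allpairs_uniq_dep => [|k _|]; try exact: iota_uniq.
    by move=> [k i] [k' i'] _ _ /= /(pcan_inj iotaK)[-> ->].
  - move=> w' nL; apply: (oriM oI); apply: um => p kw pm; apply: LP nL kw _.
    exact: leq_trans pm (leq_maxl _ _).
  rewrite big_allpairs_dep /=.
  have -> : \sum_(k <- seq.iota 0 (maxn m m')) \sum_(i <- seq.iota 0 (size (s k)))
      U x (iota (k, i)) * B (iota (k, i)) y = (f - h (maxn m m')) x y.
    have -> : seq.iota 0 (maxn m m') = index_iota 0 (maxn m m').
      by rewrite /index_iota subn0.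
    rewrite -h0.
    have -> : h 0%N - h (maxn m m') = \sum_(0 <= k < maxn m m') (h k - h k.+1).
      elim: (maxn _ _) => [|n IH]; first by rewrite big_geq // subrr.
      by rewrite big_nat_recr //= -IH addrA subrK.
    rewrite mat_sumE; apply: eq_bigr => k _.
    have [_ /orth_dec_sum-> _ _] := hs k.
    rewrite mat_sumE [RHS](big_nth 0) /index_iota subn0.
    by apply: eq_bigr => i _; rewrite UE BE ab.
  by rewrite matDE matNE subKr; apply: hm'; exact: leq_maxr.
have caseW (P : W -> Prop) : (forall p, P (iota p)) ->
    (forall w', kappa w' = None -> P w') -> forall w', P w'.
  move=> H1 H2 w'; case kw: (kappa w') => [p|]; last exact: H2.
  by rewrite -(kappaK kw).
have BUE p p' : (B * U) (iota p) (iota p') = if p == p' then d p else 0.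
  rewrite rowE -[in LHS]/((b p * U) (w p) (iota p')) colE.
  have [_ ba [_ <-] _ _] := FP p; have [_ _ [<- _] _ _] := FP p'.
  case: eqP => [<-|/ll H]; last by rewrite mulrA -(mulrA (b p)) H mulr0 mul0r.
  by have [_ _ [-> ->] _ _] := FP p; rewrite ba ptE.
exists U, B; split=> //; first (rewrite UB; split).
- apply: matP => x; apply: (caseW) => [p|w' kw]; last first.
    by rewrite Uout // mat_mul_col0 // => k; rewrite Uout.
  rewrite colE UE; have [_ _ [<- _] _ _] := FP p.
  by rewrite mulrA; have [-> _] := lf p.
- rewrite -mulrA UB; apply: matP; apply: (caseW) => [p|w' kw] y; last first.
    by rewrite Bout // mat_mul_row0 // => k; rewrite Bout.
  rewrite rowE BE; have [_ _ [_ <-] _ _] := FP p.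
  by rewrite -mulrA; have [_ ->] := lf p.
- split.
    apply: (caseW) => [p|w' kw]; apply: (caseW) => [p'|w'' kw''] ne.
    + by rewrite BUE; case: eqP => // pp'; case: ne; rewrite pp'.
    + by rewrite mat_mul_col0 // => k; rewrite Uout.
    + by rewrite mat_mul_row0 // => k; rewrite Bout.
    + by rewrite mat_mul_row0 // => k; rewrite Bout.
  apply: (caseW) => [p|w' kw].
    by rewrite BUE eqxx; have [] := FP p.
  by left; rewrite mat_mul_row0 // => k; rewrite Bout.
Qed.

End Semiperfect.

(** * Diagonalizing an arbitrary idempotent matrix *)

Section Extension.
Variables (T : pzRingType) (f a c o u v u2 b : T).

(** Idempotents [a] and [c] stand for two disjoint sets of indices, [f] maps
    [a] to [a] and [a + c] to [a + c], [u v] diagonalizes [a f], and [u2 b]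
    diagonalizes the idempotent [c f c] that [f] induces on the quotient. To
    diagonalize [(a + c) f], the new generators [b] are lifted to the image of [f]
    as [b f]. What the lifts miss of a row of [c f], namely a row of
    [c f - c f c f], is in the image of [a f], hence has coordinates with respect
    to the old generators; this is the correction term in [u']. *)
Lemma stage_extension :
  f * f = f -> o * f = f -> f * o = f ->
  a * a = a -> c * c = c -> a * c = 0 -> c * a = 0 -> o * c = c * o ->
  a * f * a = a * f -> (a + c) * f * (a + c) = (a + c) * f ->
  a * u = u -> u * a = u -> a * v = v -> v * a = v ->
  o * u = u -> u * o = 0 -> o * v = 0 -> v * o = v ->
  u * v = a * f -> u * v * u = u ->
  c * u2 = u2 -> u2 * c = u2 -> c * b = b -> b * c = b ->
  o * u2 = u2 -> u2 * o = 0 -> o * b = 0 ->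
  u2 * b = c * f * c -> u2 * b * u2 = u2 -> b * u2 * b = b ->
  let u' := u + (c * f - c * f * c * f) * u + u2 in
  let v' := v + b * f in
  [/\ [/\ (a + c) * u' = u', u' * (a + c) = u', (a + c) * v' = v' & v' * (a + c) = v'],
      [/\ o * u' = u', u' * o = 0, o * v' = 0 & v' * o = v'],
      [/\ u' * v' = (a + c) * f, u' * v' * u' = u' & v' * u' = v * u + b * u2] &
      a * u' = u /\ a * v' = v].
Proof.
move=> ff of_ fo aa cc ac ca oc af acf au ua av va ou uo ov vo uv uvu cu uc cb bc
  o2 u2o ob ub ubu bub u' v'.
rewrite {}/u' {}/v'; set s := c * f * c in ub *; set t := c * f - s * f.
have ss : s * s = s by rewrite -ub mulrA ubu.
have cs : c * s = s by rewrite /s !mulrA cc.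
have sc : s * c = s by rewrite /s -!mulrA cc.
have bs : b * s = b by rewrite -ub mulrA bub.
have os : o * s = s by rewrite /s !mulrA oc -(mulrA c) of_.
have sE : c * f * c = s by [].
have tE : c * f - s * f = t by [].
clearbody s t.
have cfac : c * f * (a + c) = c * f.
  have := congr1 (fun x => c * x) acf; rewrite !mulrA.
  by rewrite !(mulrDr c) ca cc add0r.
have cu0 : c * u = 0 by rewrite -au mulrA ca mul0r.
have u2u : u2 * u = 0 by rewrite -uc -mulrA cu0 mulr0.
have ub0 : u * b = 0 by rewrite -ua -cb mulrA -(mulrA u) ac mulr0 mul0r.
have u2v : u2 * v = 0 by rewrite -uc -av !mulrA -(mulrA u2) ca mulr0 mul0r.
have vc : v * c = 0 by rewrite -va -mulrA ac mulr0.
have ab : a * b = 0 by rewrite -cb mulrA ac mul0r.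
have ba : b * a = 0 by rewrite -bc -mulrA ca mulr0.
have sfc : s * f * c = s by rewrite -{1}sc -!mulrA (mulrA c) sE ss.
have tc : t * c = 0 by rewrite -tE mulrBl sE sfc subrr.
have ct : c * t = t by rewrite -tE mulrBr !mulrA cc cs.
have sfac : s * f * (a + c) = s * f by rewrite -{1}sc -!mulrA (mulrA c) cfac mulrA sc.
have ta : t * a = t.
  have : t * (a + c) = t by rewrite -tE mulrBl cfac sfac.
  by rewrite mulrDr tc addr0.
have tf : t * f = t by rewrite -tE mulrBl -!mulrA ff.
have at0 : a * t = 0 by rewrite -ct mulrA ac mul0r.
have ot : o * t = t by rewrite -tE mulrBr !mulrA os oc -(mulrA c) of_.
have tuv : t * u * v = t by rewrite -mulrA uv mulrA ta tf.
have bcf : b * f = b * c * f by rewrite bc.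
have bfc : b * f * c = b by rewrite bcf -!mulrA (mulrA c) sE bs.
have bt : b * t = 0 by rewrite -tE mulrBr !mulrA bs bc subrr.
have bft : b * f * t = 0 by rewrite -ct mulrA bfc bt.
have bfaf : b * f * a * f = 0.
  have bfE : b * f = b * f * a + b.
    by rewrite {1}bcf -mulrA -cfac !mulrA bc mulrDr bfc.
  have := congr1 (fun x => x * f) bfE; rewrite /= -mulrA ff mulrDl.
  by rewrite -{1}[b * f]add0r => /addIr.
have bfu : b * f * u = 0 by rewrite -uvu uv !mulrA bfaf mul0r.
have bfu2 : b * f * u2 = b * u2 by rewrite -{1}cu mulrA bfc.
have vu2 : v * u2 = 0 by rewrite -cu mulrA vc mul0r.
have vt : v * t = 0 by rewrite -ct mulrA vc mul0r.
have au2 : a * u2 = 0 by rewrite -cu mulrA ac mul0r.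
have u2a : u2 * a = 0 by rewrite -uc -mulrA ca mulr0.
have uc0 : u * c = 0 by rewrite -ua -mulrA ac mulr0.
have bfac : b * f * (a + c) = b * f by rewrite bcf -!mulrA (mulrA c) cfac.
have cv : c * v = 0 by rewrite -av mulrA ca mul0r.
have uk : u * (a + c) = u by rewrite mulrDr ua uc0 addr0.
have u2k : u2 * (a + c) = u2 by rewrite mulrDr uc u2a add0r.
have vk : v * (a + c) = v by rewrite mulrDr va vc addr0.
pose D := (mulrDl, mulrDr).
have vuE : (v + b * f) * (u + t * u + u2) = v * u + b * u2.
  by rewrite !D !mulrA vt vu2 bfu bft bfu2 !mul0r !addr0 !add0r.
split; split => //.
- by rewrite !D !mulrA au at0 au2 cu0 ct cu mul0r !add0r !addr0 addrA.
- by rewrite !mulrDl -(mulrA t) uk u2k.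
- by rewrite !D !mulrA av cv ab cb mul0r add0r addr0.
- by rewrite mulrDl vk bfac.
- by rewrite !D !mulrA ou ot o2.
- by rewrite !D -!mulrA uo u2o mulr0 !addr0.
- by rewrite !D !mulrA ov ob !mul0r addr0.
- by rewrite !D -!mulrA vo fo.
- rewrite !D !mulrA uv ub tuv ub0 u2v -(mulrA t) ub0 mulr0 !mul0r !addr0.
  by rewrite add0r -addrA -tE subrK.
- rewrite -mulrA vuE !D !mulrA uvu ub0 u2v ubu tuv -(mulrA t u b) ub0 mulr0.
  by rewrite !mul0r !addr0 add0r.
- by rewrite !D !mulrA au at0 au2 mul0r !addr0.
- by rewrite mulrDr mulrA ab av mul0r addr0.
Qed.
End Extension.

Lemma countable_closure (X : Type) (N : X -> set X) (x0 : X) :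
  (forall x, countable (N x)) ->
  exists C : set X, [/\ countable C, C x0 & forall x y, C x -> N x y -> C y].
Proof.
move=> cN; pose S := fix S n := if n is n'.+1 then \bigcup_(x in S n') N x else [set x0].
exists (\bigcup_n S n); split.
- by apply: bigcup_countable => // n _; elim: n => //= n IH; apply: bigcup_countable.
- by exists 0%N.
- by move=> x y [n _ Sx] Nxy; exists n.+1 => //; exists x.
Qed.

Section Kaplansky.
Variables (R : crlTopRingType) (Z : Type) (e : Z -> R).
Hypotheses (e_zc : zero_convergent e) (e_orth : forall z z', z <> z' -> e z * e z' = 0)
  (e_sum : topsum e = 1) (e_local : forall z, local_idempotent (e z))
  (cbR : countable_base_at_zero R).
Variable X : Type.
Let W : Type := (X * option (nat * nat))%type.

(** Above each [x] in [X] there are the index [(x, None)], where the given matrix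
    [f] lives, and countably many further ones, where the diagonal form is built.
    In this way a single ring contains [f], the matrices [u] and [v], and
    the diagonal matrix [v u]. *)
Definition over (A : set X) : mat R W := proj R [set w | A w.1].
Definition orig : mat R W := proj R [set w | w.2 = None].

Lemma overI A B : over A * over B = over (A `&` B).
Proof. by rewrite /over projI. Qed.
Lemma over_sub A B : A `<=` B -> over A * over B = over A.
Proof. by move=> AB; rewrite overI; congr over; apply/setIidl. Qed.
Lemma over_disj A B : A `&` B = set0 -> over A * over B = 0.
Proof. by move=> AB; rewrite overI AB /over -(proj0 R W). Qed.
Lemma overU A B : A `&` B = set0 -> over (A `|` B) = over A + over B.
Proof.
move=> AB; rewrite /over -projD //.
apply/seteqP; split=> // -[x ?] /= [Ax Bx]; suff : set0 x by [].
by rewrite -AB.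
Qed.
Lemma over_orig A : orig * over A = over A * orig.
Proof. exact: projC. Qed.

Variable f : mat R W.
Hypotheses (ff : f * f = f) (of_ : orig * f = f) (fo : f * orig = f).

(** A diagonalization of the part of [f] above an [f]-closed set [A]. *)
Record stage (A : set X) (u v : mat R W) : Prop := Stage {
  stage_closed : over A * f * over A = over A * f ;
  stage_au : over A * u = u ; stage_ua : u * over A = u ;
  stage_av : over A * v = v ; stage_va : v * over A = v ;
  stage_ou : orig * u = u ; stage_uo : u * orig = 0 ;
  stage_ov : orig * v = 0 ; stage_vo : v * orig = v ;
  stage_uv : u * v = over A * f ; stage_uvu : u * v * u = u ;
  stage_diag : diagonal_of_locals e (v * u) }.

Lemma over_closed (A : set X) :
  (forall x y, A x -> f (x, None) (y, None) <> 0 -> A y) ->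
  over A * f * over A = over A * f.
Proof.
move=> cA; rewrite -of_ -fo; apply: matP => -[x i] [y j].
rewrite mul_proj !mulrA mul_proj -over_orig -!mulrA !proj_mul /=.
case: (asboolP (j = None)) => [->|_]; last by rewrite if_same.
case: (asboolP (i = None)) => [->|_]; last by rewrite if_same.
case: (asboolP (A x)) => [Ax|_]; last by rewrite if_same.
case: asboolP => // nAy; apply: contrapT => fxy; apply: nAy; apply: cA Ax _ => E.
by apply: fxy; rewrite E.
Qed.

(** Rows of [f] have countable support, so the [f]-closed set generated by a
    further index adds only countably many new ones. *)
Lemma extend A u v x0 : stage A u v -> ~ A x0 ->
  exists A' u' v', [/\ stage A' u' v', A `<=` A', A' x0,
    over A * u' = u & over A * v' = v].
Proof.
case=> af au ua av va ou uo ov vo uv uvu dvu nA.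
pose N x : set X := [set y | f (x, None) (y, None) <> 0].
have cN x : countable (N x).
  have /countable_injP[i iinj] := countable_support cbR (@coef_zc _ _ (f (x, None))).
  apply/countable_injP; exists (fun y => i (y, None)) => y y'; rewrite !inE => fy fy' E.
  by have := iinj (y, None) (y', None); rewrite !inE => /(_ fy fy' E)[].
have [C' [cC' C'x0 C'N]] := countable_closure x0 cN.
pose C := C' `\` A.
have Cx0 : C x0 by split.
have AC : A `&` C = set0 by apply/seteqP; split=> // x [? []].
have CA : C `&` A = set0 by rewrite setIC.
have /countable_injP[idx idxinj] : countable C.
  by apply: sub_countable cC'; apply: subset_card_le => x [].
have [I [oI IJ]] := countable_ideal_base cbR.
have aa : over A * over A = over A by exact: over_sub.
have cc : over C * over C = over C by exact: over_sub.
have acf : (over A + over C) * f * (over A + over C) = (over A + over C) * f.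
  rewrite -overU //; apply: over_closed => x y [Ax|Cx] fxy.
    left; apply: contrapT => nAy; apply: fxy.
    have := congr1 (fun m : mat R W => m (x, None) (y, None)) af.
    by rewrite mul_proj !proj_mul /= asboolF // asboolT.
  have [Ay|nAy] := pselect (A y); [by left|right; split=> //].
  by apply: C'N fxy; case: Cx.
have ac := over_disj AC; have ca := over_disj CA.
(* The idempotent that f induces on the quotient by the part above A. *)
have [s sdef] : exists s, s = over C * f * over C by eexists.
have ss : s * s = s.
  have cfc : over C * f * (over A + over C) = over C * f.
    have := congr1 (fun x => over C * x) acf; rewrite /= !mulrA.
    by rewrite !(mulrDr (over C)) ca cc add0r.
  have caf : over A * f * over C = 0.
    by rewrite -af -mulrA ac mulr0.
  have sE : s = over C * f - over C * f * over A.
    by rewrite -[X in X - _]cfc mulrDr addrC addKr sdef.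
  have sc : s * over C = s by rewrite sdef -mulrA cc.
  have z : over C * f * over A * f * over C = 0.
    by rewrite -!mulrA (mulrA (over A)) caf !mulr0.
  by rewrite {2}sdef !mulrA sc {1}sE !mulrBl -(mulrA _ f f) ff z subr0.
have os : orig * s = s by rewrite sdef !mulrA over_orig -(mulrA (over C)) of_.
have sout x y : ~ (C x.1 /\ x.2 = None) -> s x y = 0.
  move=> nx; rewrite -os proj_mul; case: asboolP => // xN.
  rewrite sdef -mulrA proj_mul; case: asboolP => // Cx; by case: nx.
(* C being countable, the pairs of an index in C and a basic open right ideal
   can be listed in one sequence. *)
have [q [oq fq]] : exists q : nat -> W * set R, (forall k, open_right_ideal (q k).2) /\
    forall x n, C x -> exists k, q k = ((x, None), I n).
  have H i : exists y, forall x, C x -> idx x = i -> x = y.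
    have [[y [Cy iy]]|nH] := pselect (exists y, C y /\ idx y = i).
      by exists y => x Cx ix; apply: idxinj; rewrite ?inE // ix iy.
    by exists x0 => x Cx ix; case: nH; exists x.
  have [g gP] := choice H.
  exists (fun k => if (choice.unpickle k : option (nat * nat)) is Some (i, n)
    then ((g i, @None _), I n) else ((x0, @None _), I 0%N)).
  split; first by move=> k; case: choice.unpickle => [[i n]|] /=.
  by move=> x n Cx; exists (choice.pickle (idx x, n)); rewrite choice.pickleK -(gP _ x).
pose kappa (w : W) := if `[< w.1 = x0 >] then w.2 else None.
have [|||u2 [b [ub [ubu bub] dbu u2out bout]]] :=
    @diagonalize R W Z e e_zc e_orth e_sum e_local kappa
      (fun p => (x0, Some p)) _ _ s q ss oq.
- by move=> p; rewrite /kappa asboolT.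
- by move=> [x i] p; rewrite /kappa /=; case: asboolP => // -> ->.
- move=> x J oJ; have [[]|nx] := pselect (C x.1 /\ x.2 = None).
    case: x => x i /= Cx ->; right; have [n nJ] := IJ J oJ.
    by have [k qk] := fq x n Cx; exists k; rewrite qk.
  by left=> y; exact: sout.
have fu2 : s * u2 = u2 by rewrite -ub.
have bf : b * s = b by rewrite -ub mulrA.
have over_out (a : mat R W) : (forall x w, kappa w = None -> a x w = 0) ->
    a * over C = a /\ a * orig = 0.
  move=> a0; split; apply: matP => x w; rewrite mul_proj.
    case: asboolP => // nC; rewrite a0 // /kappa asboolF // => wx.
    by apply: nC; rewrite /= wx.
  by case: asboolP => // wN; rewrite a0 // /kappa wN if_same.
have out_over (a : mat R W) : (forall w y, kappa w = None -> a w y = 0) ->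
    over C * a = a /\ orig * a = 0.
  move=> a0; split; apply: matP => w y; rewrite proj_mul.
    case: asboolP => // nC; rewrite a0 // /kappa asboolF // => wx.
    by apply: nC; rewrite /= wx.
  by case: asboolP => // wN; rewrite a0 // /kappa wN if_same.
have [u2c u2o] := over_out _ u2out.
have [cb ob] := out_over _ bout.
have cs : over C * s = s by rewrite sdef !mulrA cc.
have sc : s * over C = s by rewrite sdef -mulrA cc.
have cu2 : over C * u2 = u2 by rewrite -fu2 mulrA cs.
have bc : b * over C = b by rewrite -bf -mulrA sc.
have ou2 : orig * u2 = u2 by rewrite -fu2 mulrA os.
have [] := @stage_extension (mat R W) f (over A) (over C) orig u v u2 b ff of_ fo
  aa cc ac ca (over_orig C) af acf au ua av va ou uo ov vo uv uvu cu2 u2c cb bc ou2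
  u2o ob _ ubu bub.
  by rewrite ub.
move=> [H1 H2 H3 H4] [H5 H6 H7 H8] [H9 H10 H11] [H12 H13].
exists (A `|` C); do 2 eexists; split; [|by left|by right|exact: H12|exact: H13].
split=> //; rewrite ?overU // H11.
have [d1 d2] := dvu; have [d3 d4] := dbu; split.
  by move=> x y xy; rewrite matDE d1 // d3 // addr0.
move=> x; rewrite matDE; have [xA|nxA] := pselect (A x.1).
  suff -> : (b * u2) x x = 0 by rewrite addr0; exact: d2.
  rewrite -cb -mulrA proj_mul asboolF // => xC.
  by suff : set0 x.1 by []; rewrite -AC.
suff -> : (v * u) x x = 0 by rewrite add0r; exact: d4.
by rewrite -av -mulrA proj_mul asboolF.
Qed.

Lemma stage0 : stage set0 0 0.
Proof.
have o0 : over set0 = 0 by rewrite /over -(proj0 R W).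
split; rewrite ?o0 ?mul0r ?mulr0 //; split=> //.
by left.
Qed.

Let stageT := {t : set X * (mat R W * mat R W) | stage t.1 t.2.1 t.2.2}.

Definition stage_le (s t : stageT) : Prop :=
  [/\ (sval s).1 `<=` (sval t).1, over (sval s).1 * (sval t).2.1 = (sval s).2.1
    & over (sval s).1 * (sval t).2.2 = (sval s).2.2].

(** Along a chain, each row is fixed from the first stage that reaches it on. *)
Lemma glue (F : set stageT) (m : stageT -> mat R W) :
  (forall s t, F s -> F t ->
     over (sval s).1 * m t = m s \/ over (sval t).1 * m s = m t) ->
  (forall t, over (sval t).1 * m t = m t) ->
  exists M, over (\bigcup_(t in F) (sval t).1) * M = M /\
    forall t, F t -> over (sval t).1 * M = m t.
Proof.
move=> mF mt.
have row (w : W) : exists r : formal_sum R W,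
    (forall t, F t -> (sval t).1 w.1 -> m t w = r) /\
    (~ (\bigcup_(t in F) (sval t).1) w.1 -> r = fs_zero R W).
  have [[t [Ft tw]]|nw] := pselect (exists t, F t /\ (sval t).1 w.1); last first.
    by exists (fs_zero R W); split=> // t Ft tw; case: nw; exists t.
  exists (m t w); split; last by case; exists t.
  move=> t' Ft' tw'; apply: formal_sumP => y.
  by have [<-|<-] := mF t t' Ft Ft'; rewrite proj_mul asboolT.
have [M MP] := choice row; exists M; split.
  apply: matP => w y; rewrite proj_mul; case: asboolP => // nw.
  by have [_ ->] := MP w.
move=> t Ft; apply: matP => w y; rewrite proj_mul; case: asboolP => [tw|nw].
  by have [/(_ t Ft tw) ->] := MP w.
by rewrite -mt proj_mul asboolF.
Qed.

Lemma chain_bound (F : set stageT) :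
  total_on F (fun s t => `[< stage_le s t >]) ->
  exists t, forall s, F s -> stage_le s t.
Proof.
move=> tF; pose B := \bigcup_(t in F) (sval t).1.
have sP (t : stageT) := svalP t.
have [||u [Bu uF]] := @glue F (fun t => (sval t).2.1).
- by move=> s t Fs Ft; case: (tF s t Fs Ft) => /asboolP[]; [left|right].
- by move=> t; have [] := sP t.
have [||v [Bv vF]] := @glue F (fun t => (sval t).2.2).
- by move=> s t Fs Ft; case: (tF s t Fs Ft) => /asboolP[]; [left|right].
- by move=> t; have [] := sP t.
have tB t : F t -> over (sval t).1 * over B = over (sval t).1.
  by move=> Ft; apply: over_sub => x tx; exists t.
have local (a b : mat R W) : over B * a = a -> over B * b = b ->
    (forall t, F t -> over (sval t).1 * a = over (sval t).1 * b) -> a = b.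
  move=> Ba Bb H; rewrite -Ba -Bb; apply: matP => w y; rewrite !proj_mul.
  case: asboolP => // -[t Ft tw].
  have := congr1 (fun m : mat R W => m w y) (H t Ft).
  by rewrite !proj_mul asboolT.
have BB : over B * over B = over B by exact: over_sub.
have uv : u * v = over B * f.
  apply: local; rewrite ?mulrA ?Bu ?BB // => t Ft.
  have [_ _ ua _ _ _ _ _ _ tuv _ _] := sP t.
  by rewrite !mulrA uF // tB // -ua -mulrA vF // tuv.
have st : stage B u v.
  split=> //.
  - apply: local; rewrite ?mulrA ?BB // => t Ft; rewrite !mulrA tB //.
    by have [<- _ _ _ _ _ _ _ _ _ _ _] := sP t; rewrite -mulrA tB.
  - apply: local; rewrite ?mulrA ?Bu // => t Ft; rewrite !mulrA uF //.
    by have [_ _ <- _ _ _ _ _ _ _ _ _] := sP t; rewrite -mulrA tB.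
  - apply: local; rewrite ?mulrA ?Bv // => t Ft; rewrite !mulrA vF //.
    by have [_ _ _ _ <- _ _ _ _ _ _ _] := sP t; rewrite -mulrA tB.
  - apply: local; rewrite ?mulrA -?over_orig -?mulrA ?Bu // => t Ft.
    rewrite mulrA -over_orig -mulrA uF //.
    by have [_ _ _ _ _ -> _ _ _ _ _ _] := sP t.
  - apply: local; rewrite ?mulrA ?mulr0 ?Bu // => t Ft; rewrite mulr0 mulrA uF //.
    by have [_ _ _ _ _ _ -> _ _ _ _ _] := sP t.
  - apply: local; rewrite ?mulr0 // ?mulrA -?over_orig -?mulrA ?Bv // => t Ft.
    rewrite mulr0 mulrA -over_orig -mulrA vF //.
    by have [_ _ _ _ _ _ _ -> _ _ _ _] := sP t.
  - apply: local; rewrite ?mulrA ?Bv // => t Ft; rewrite !mulrA vF //.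
    by have [_ _ _ _ _ _ _ _ -> _ _ _] := sP t.
  - apply: local; rewrite ?mulrA ?Bu // => t Ft; rewrite !mulrA uF //.
    have [ta tau tua tav tva _ _ _ _ tuv tuvu _] := sP t.
    rewrite -[X in X * v * u = _]tua -(mulrA _ _ v) vF // -{1}tva.
    by rewrite -!mulrA uF // mulrA.
  - have dt t w : F t -> (sval t).1 w.1 ->
        (v * u) w = ((sval t).2.2 * (sval t).2.1) w.
      move=> Ft tw; apply: formal_sumP => y.
      have [_ _ _ _ va _ _ _ _ _ _ _] := sP t.
      have -> : (sval t).2.2 * (sval t).2.1 = over (sval t).1 * (v * u).
        by rewrite mulrA vF // -[in RHS]va -mulrA uF.
      by rewrite proj_mul asboolT.
    have d0 w y : ~ B w.1 -> (v * u) w y = 0.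
      by move=> nw; rewrite -Bv -mulrA proj_mul asboolF.
    split=> [x y xy|x].
      have [[t Ft tx]|/d0//] := pselect (B x.1).
      by rewrite (dt t) //; have [_ _ _ _ _ _ _ _ _ _ _ [d _]] := sP t; exact: d.
    have [[t Ft tx]|/d0//] := pselect (B x.1); last by left.
    by rewrite (dt t) //; have [_ _ _ _ _ _ _ _ _ _ _ [_ d]] := sP t; exact: d.
exists (exist _ (B, (u, v)) st) => s Fs; split => /=; last 2 first.
- exact: uF.
- exact: vF.
by move=> x sx; exists s.
Qed.

(** Kaplansky's argument: a maximal stage is defined above all of [X]. *)
Lemma diagonalize_all : exists u v : mat R W,
  [/\ u * v = f, u * v * u = u & diagonal_of_locals e (v * u)].
Proof.
have [|||[[A [u v]] st] stmax] := @ZL_preorder stageT (exist _ (set0, (0, 0)) stage0)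
  (fun s t => `[< stage_le s t >]).
- move=> [[A [u v]] st]; apply/asboolP; split=> //=; by case: st.
- move=> [[A [u v]] sr] [[A' [u' v']] ss] [[A'' [u'' v'']] s''].
  move=> /asboolP[/= H1 H2 H3] /asboolP[/= H4 H5 H6].
  apply/asboolP; split=> /=; first exact: subset_trans H4.
    by rewrite -H2 -H5 mulrA over_sub // -H2 -H5.
  by rewrite -H3 -H6 mulrA over_sub // -H3 -H6.
- move=> F /chain_bound[t tb]; exists t => s Fs; exact/asboolP/tb.
have At : A = setT.
  apply/seteqP; split=> // x _; apply: contrapT => nAx.
  have [A' [u' [v' [st' AA' A'x au av]]]] := extend st nAx.
  have /asboolP[/= A'A _ _] := stmax (exist _ (A', (u', v')) st')
    (introT (asboolP _) (And3 AA' au av)).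
  exact/nAx/A'A.
exists u, v; case: (st) => /= _ _ _ _ _ _ _ _ _ uv uvu dvu; split=> //.
rewrite uv At.
have -> : over setT = 1 by rewrite /over -(projT R W).
by rewrite mul1r.
Qed.
End Kaplansky.

(** * Infinite linear combinations in contramodules *)

Section LinearCombinations.
Variable R : crlTopRingType.
Implicit Types C D : contramodule R.

Definition fs_scale X (r : R) (t : formal_sum R X) : formal_sum R X :=
  FormalSum (zero_convergent_mull r (@coef_zc _ _ t)).

Lemma fs_addE X (s t : formal_sum R X) x : fs_add s t x = s x + t x.
Proof. by []. Qed.

Lemma fs_scaleE X r (t : formal_sum R X) x : fs_scale r t x = r * t x.
Proof. by []. Qed.

Definition fs_bind X Y (t : formal_sum R X) (T : X -> formal_sum R Y) :=
  fs_mul (fs_map T t).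

Lemma fs_bindE X Y (t : formal_sum R X) (T : X -> formal_sum R Y) y :
  fs_bind t T y = topsum (fun x => t x * T x y).
Proof. exact: topsum_fs_map T t (fun s => s y). Qed.

Lemma coef_mul_zc X (t : formal_sum R X) (g : X -> R) :
  zero_convergent (fun x => t x * g x).
Proof. exact/zero_convergent_mulr/coef_zc. Qed.

Lemma fs_bindA X Y V (t : formal_sum R X) (T : X -> formal_sum R Y)
    (U : Y -> formal_sum R V) :
  fs_bind (fs_bind t T) U = fs_bind t (fun x => fs_bind (T x) U).
Proof.
apply: formal_sumP => v; rewrite !fs_bindE.
rewrite [LHS](topsum_fs_mul (fs_map T t) (fun y => U y v)).
rewrite (topsum_fs_map T t (fun s => topsum (fun y => s y * U y v))).
by congr topsum; apply/funext => x; rewrite fs_bindE.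
Qed.

Lemma fs_bind_unit X Y x (T : X -> formal_sum R Y) : fs_bind (fs_unit R x) T = T x.
Proof.
apply: formal_sumP => y; rewrite fs_bindE (topsum_one (x0 := x)) /=.
  by rewrite asboolT // mul1r.
by move=> z zx; rewrite asboolF ?mul0r // => /esym.
Qed.

Lemma fs_mapE X Y (f : X -> Y) (t : formal_sum R X) :
  fs_map f t = fs_bind t (fun x => fs_unit R (f x)).
Proof. by apply: formal_sumP => y; rewrite fs_bindE /= fiber_partE. Qed.

Lemma fs_map_id X (t : formal_sum R X) : fs_map id t = t.
Proof.
apply: formal_sumP => y; rewrite fs_mapE fs_bindE (topsum_one (x0 := y)) /=.
  by rewrite asboolT // mulr1.
by move=> z zy; rewrite asboolF ?mulr0.
Qed.

Lemma fs_bindDl X Y (s t : formal_sum R X) (T : X -> formal_sum R Y) :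
  fs_bind (fs_add s t) T = fs_add (fs_bind s T) (fs_bind t T).
Proof.
apply: formal_sumP => y; rewrite fs_addE !fs_bindE.
rewrite -topsumD; [|exact: coef_mul_zc..].
by congr topsum; apply/funext => x /=; rewrite mulrDl.
Qed.

Lemma fs_bindDr X Y (t : formal_sum R X) (T U : X -> formal_sum R Y) :
  fs_bind t (fun x => fs_add (T x) (U x)) = fs_add (fs_bind t T) (fs_bind t U).
Proof.
apply: formal_sumP => y; rewrite fs_addE !fs_bindE.
rewrite -topsumD; [|exact: coef_mul_zc..].
by congr topsum; apply/funext => x /=; rewrite mulrDr.
Qed.

Lemma fs_bindZ X Y r (t : formal_sum R X) (T : X -> formal_sum R Y) :
  fs_bind (fs_scale r t) T = fs_scale r (fs_bind t T).
Proof.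
apply: formal_sumP => y; rewrite fs_scaleE !fs_bindE.
rewrite -topsum_mull; last exact: coef_mul_zc.
by congr topsum; apply/funext => x /=; rewrite mulrA.
Qed.

Lemma fs_bind0 X Y (t : formal_sum R X) :
  fs_bind t (fun _ => fs_zero R Y) = fs_zero R Y.
Proof.
apply: formal_sumP => y; rewrite fs_bindE /= -[RHS](topsum0 R X).
by congr topsum; apply/funext => x; rewrite mulr0.
Qed.

Definition lincomb X C (g : X -> C) (t : formal_sum R X) : C :=
  contraaction (fs_map g t).

Lemma lincomb_bind X Y C (g : Y -> C) (t : formal_sum R X) (T : X -> formal_sum R Y) :
  lincomb g (fs_bind t T) = lincomb (fun x => lincomb g (T x)) t.
Proof.
rewrite /lincomb /fs_bind -fs_mul_nat -contra_assoc !fs_map_comp.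
by [].
Qed.

Lemma lincomb_unit X C (g : X -> C) x : lincomb g (fs_unit R x) = g x.
Proof. by rewrite /lincomb fs_map_unit contra_unit. Qed.

Lemma hom_lincomb X C D (h : contra_hom C D) (g : X -> C) t :
  h (lincomb g t) = lincomb (h \o g) t.
Proof. by rewrite /lincomb hom_contra fs_map_comp. Qed.

Lemma contraactionE C (t : formal_sum R C) : contraaction t = lincomb id t.
Proof. by rewrite /lincomb fs_map_id. Qed.

Lemma contraactionD C (s t : formal_sum R C) :
  contraaction (fs_add s t) = contra_add (contraaction s) (contraaction t).
Proof.
have -> : fs_add s t = fs_bind (fs_add (fs_unit R s) (fs_unit R t)) id.
  by rewrite fs_bindDl !fs_bind_unit.
rewrite /fs_bind fs_map_id -contra_assoc; congr contraaction.
by rewrite fs_mapE fs_bindDl !fs_bind_unit.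
Qed.

Lemma lincomb0 X C (g : X -> C) : lincomb g (fs_zero R X) = contra_zero C.
Proof.
rewrite /lincomb /contra_zero; congr contraaction.
apply: formal_sumP => y; rewrite fs_mapE fs_bindE /= -[RHS](topsum0 R X).
by congr topsum; apply/funext => x; rewrite mul0r.
Qed.

Lemma lincombDl X C (g : X -> C) (s t : formal_sum R X) :
  lincomb g (fs_add s t) = contra_add (lincomb g s) (lincomb g t).
Proof. by rewrite /lincomb -contraactionD !fs_mapE fs_bindDl. Qed.

Lemma contra_addE C (a b : C) : contra_add a b =
  lincomb id (fs_add (fs_unit R a) (fs_unit R b)).
Proof. by rewrite -contraactionE. Qed.

Lemma lincombDr X C (g h : X -> C) (t : formal_sum R X) :
  lincomb (fun x => contra_add (g x) (h x)) t = contra_add (lincomb g t) (lincomb h t).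
Proof.
have -> : (fun x => contra_add (g x) (h x)) =
    (fun x => lincomb id (fs_add (fs_unit R (g x)) (fs_unit R (h x)))).
  by apply/funext => x; rewrite contra_addE.
rewrite -lincomb_bind.
by rewrite fs_bindDr lincombDl -!fs_mapE /lincomb !fs_map_id.
Qed.

Lemma lincomb_cst0 X C (t : formal_sum R X) :
  lincomb (fun _ => contra_zero C) t = contra_zero C.
Proof.
rewrite -{1}(lincomb0 (@id C)) -(lincomb_bind id t (fun _ => fs_zero R C)).
by rewrite fs_bind0 lincomb0.
Qed.

Lemma hom_zero C D (h : contra_hom C D) : h (contra_zero C) = contra_zero D.
Proof. by rewrite -(lincomb0 (@id C)) hom_lincomb lincomb0. Qed.

(** ** The abelian group underlying a contramodule *)

Lemma contra_addA C (a b c : C) :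
  contra_add a (contra_add b c) = contra_add (contra_add a b) c.
Proof.
rewrite -(contra_unit a) -(contra_unit b) -(contra_unit c) -!contraactionD.
by congr contraaction; apply: formal_sumP => x /=; rewrite addrA.
Qed.

Lemma contra_addC C (a b : C) : contra_add a b = contra_add b a.
Proof.
by rewrite !contra_addE; congr lincomb; apply: formal_sumP => x /=; rewrite addrC.
Qed.

Lemma contra_add0 C (a : C) : contra_add a (contra_zero C) = a.
Proof.
rewrite -{1}(lincomb_unit id a) -(lincomb0 (@id C)) -lincombDl -[RHS](lincomb_unit id a).
by congr lincomb; apply: formal_sumP => x /=; rewrite addr0.
Qed.

Lemma contra_add_opp C (a : C) :
  contra_add a (lincomb id (fs_scale (-1) (fs_unit R a))) = contra_zero C.
Proof.
rewrite -{1}(lincomb_unit id a) -lincombDl -(lincomb0 (@id C)).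
by congr lincomb; apply: formal_sumP => x /=; rewrite mulN1r subrr.
Qed.

Lemma sub_lincomb C (L : set C) X (g : X -> C) t : subcontramodule L ->
  (forall x, L (g x)) -> L (lincomb g t).
Proof.
move=> sL Lg; pose g' x : {c | L c} := exist _ (g x) (Lg x).
have -> : lincomb g t = contraaction (fs_map sval (fs_map g' t)).
  by rewrite fs_map_comp.
exact: sL.
Qed.

Lemma sub0 C (L : set C) : subcontramodule L -> L (contra_zero C).
Proof.
move=> sL; rewrite -(lincomb0 (fun v : void => of_void C v)).
by apply: sub_lincomb => // -[].
Qed.

Lemma subD C (L : set C) a b : subcontramodule L -> L a -> L b -> L (contra_add a b).
Proof.
move=> sL La Lb.
pose g (i : bool) := if i then a else b.
have -> : contra_add a b = lincomb g (fs_add (fs_unit R true) (fs_unit R false)).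
  by rewrite lincombDl !lincomb_unit.
by apply: sub_lincomb => // -[].
Qed.

Lemma lincomb_point X C (g : X -> C) r x : lincomb g (fs_scale r (fs_unit R x)) =
  lincomb (fun _ : unit => g x) (fs_scale r (fs_unit R tt)).
Proof. by rewrite /lincomb !fs_mapE !fs_bindZ !fs_bind_unit. Qed.

Lemma subZ C (L : set C) r a : subcontramodule L -> L a ->
  L (lincomb id (fs_scale r (fs_unit R a))).
Proof.
move=> sL La.
have -> : lincomb id (fs_scale r (fs_unit R a)) =
    lincomb (fun _ : unit => a) (fs_scale r (fs_unit R tt)).
  exact: lincomb_point.
exact: sub_lincomb.
Qed.

(** ** Quotients, and surjectivity of epimorphisms *)

Section Retract.
(** Quotients are realized on a set of representatives, singled out by [rho];
    this avoids quotient types. *)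
Variables (C : contramodule R) (rho : C -> C).
Hypotheses (rhoK : forall c, rho (rho c) = rho c)
  (rho_contra : forall t : formal_sum R C,
     rho (contraaction (fs_map rho t)) = rho (contraaction t)).

Definition retract_action (t : formal_sum R {c | rho c = c}) : {c | rho c = c} :=
  exist _ (rho (contraaction (fs_map sval t))) (rhoK _).

Lemma retract_assoc T :
  retract_action (fs_map retract_action T) = retract_action (fs_mul T).
Proof.
apply: eq_exist => /=; rewrite -[in RHS]fs_mul_nat -contra_assoc !fs_map_comp.
rewrite -[RHS]rho_contra fs_map_comp.
by [].
Qed.

Lemma retract_unit c : retract_action (fs_unit R c) = c.
Proof. by case: c => c cE; apply: eq_exist; rewrite fs_map_unit contra_unit. Qed.

Definition retract : contramodule R := Contramodule retract_assoc retract_unit.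

Definition retract_fun (c : C) : retract := exist _ (rho c) (rhoK c).

Lemma retract_hom (t : formal_sum R C) :
  retract_fun (contraaction t) = contraaction (fs_map retract_fun t).
Proof. by apply: eq_exist; rewrite fs_map_comp -[LHS]rho_contra. Qed.

Definition retract_map : contra_hom C retract := ContraHom retract_hom.
End Retract.

Lemma quotient_exists C (L : set C) : subcontramodule L ->
  exists (Q : contramodule R) (p : contra_hom C Q),
    (forall q, exists c, p c = q) /\ forall c, p c = contra_zero Q <-> L c.
Proof.
move=> sL; pose rel c d := exists2 l, L l & d = contra_add c l.
have rel_refl c : rel c c by exists (contra_zero C); rewrite ?contra_add0 //; exact: sub0.
have rel_sym c d : rel c d -> rel d c.
  move=> [l Ll ->]; exists (lincomb id (fs_scale (-1) (fs_unit R l))); first exact: subZ.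
  by rewrite -contra_addA contra_add_opp contra_add0.
have rel_trans c d b : rel c d -> rel d b -> rel c b.
  move=> [l Ll ->] [l' Ll' ->]; exists (contra_add l l'); first exact: subD.
  by rewrite contra_addA.
pose rho (c : C) : C := @xget {classic C} (contra_zero C) [set d | rel c d].
have rhoP c : rel c (rho c).
  exact: (@xgetI {classic C} _ [set d | rel c d] c (rel_refl c)).
have rho_eq c d : rel c d -> rho c = rho d.
  move=> cd; rewrite /rho; have -> : [set b | rel c b] = [set b | rel d b]; last by [].
  by apply/seteqP; split=> b /=; apply: rel_trans; [exact: rel_sym|].
have rhoK c : rho (rho c) = rho c by apply/esym/rho_eq.
have rho_contra (t : formal_sum R C) :
    rho (contraaction (fs_map rho t)) = rho (contraaction t).
  apply/esym/rho_eq.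
  have H c : exists l, L l /\ rho c = contra_add c l by have [l] := rhoP c; exists l.
  have [l lP] := choice H.
  exists (lincomb l t); first by apply: sub_lincomb => // c; have [] := lP c.
  rewrite -[LHS]/(lincomb rho t) contraactionE -lincombDr; congr lincomb.
  by apply/funext => c; have [] := lP c.
exists (retract rhoK rho_contra), (retract_map rhoK rho_contra); split.
  by move=> [c cE]; exists c; apply: eq_exist.
move=> c; rewrite -(hom_zero (retract_map rhoK rho_contra)); split=> [|Lc].
  move=> /(congr1 sval) /= E; have := rhoP (contra_zero C); rewrite -E.
  move=> /rel_trans /(_ (rel_sym _ _ (rhoP c)))[l Ll ->].
  by rewrite contra_addC contra_add0.
apply: eq_exist; apply/esym/rho_eq; exists c => //.
by rewrite contra_addC contra_add0.
Qed.

Lemma zero_hom_exists C D : exists z : contra_hom C D, forall c, z c = contra_zero D.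
Proof.
have H (t : formal_sum R C) :
    contra_zero D = contraaction (fs_map (fun _ => contra_zero D) t).
  by rewrite -[RHS]/(lincomb _ t) lincomb_cst0.
by exists (ContraHom H).
Qed.

(** An epimorphism is surjective, as it equalizes the zero map and the
    projection onto the quotient by its image. *)
Lemma epi_surj C D (p : contra_hom C D) : epi p -> forall d, exists c, p c = d.
Proof.
move=> ep; pose L : set D := [set d | exists c, p c = d].
have sL : subcontramodule L.
  move=> t; have [g gP] := choice (fun x : {d | L d} => svalP x).
  exists (lincomb g t); rewrite hom_lincomb /lincomb; congr contraaction.
  by congr fs_map; apply/funext.
have [Q [q [_ qL]]] := quotient_exists sL; have [z z0] := zero_hom_exists D Q.
move=> d; apply/qL; rewrite -(z0 d); apply: ep => c; rewrite z0.
by apply/qL; exists c.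
Qed.

Lemma surj_epi C D (p : contra_hom C D) : (forall d, exists c, p c = d) -> epi p.
Proof. by move=> sp E g h gh d; have [c <-] := sp d. Qed.

End LinearCombinations.

Section FreeRetract.
Variables (R : crlTopRingType) (P : contramodule R).

Lemma free_assoc (X : Type) (T : formal_sum R (formal_sum R (formal_sum R X))) :
  fs_mul (fs_map (@fs_mul R X) T) = fs_mul (fs_mul T).
Proof.
apply: formal_sumP => x.
rewrite [LHS](topsum_fs_map (@fs_mul R X) T (fun s => s x)).
by rewrite [RHS](topsum_fs_mul T (fun s => s x)).
Qed.

Lemma free_unit (X : Type) (t : formal_sum R X) : fs_mul (fs_unit R t) = t.
Proof. by rewrite -{1}(fs_map_id (fs_unit R t)) -[LHS]/(fs_bind _ id) fs_bind_unit. Qed.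

Definition free (X : Type) : contramodule R :=
  Contramodule (@free_assoc X) (@free_unit X).

(** The contraaction is an epimorphism from the free contramodule on the carrier
    of [P], so it splits. *)
Lemma projective_section : projective P ->
  exists g : P -> formal_sum R P,
    (forall x, contraaction (g x) = x) /\
    forall t : formal_sum R P, g (contraaction t) = fs_bind t g.
Proof.
move=> pP.
have H (t : formal_sum R (free P)) :
    @contraaction R P (@contraaction R (free P) t) =
    contraaction (fs_map (@contraaction R P) t).
  by rewrite -contra_assoc.
have H1 (t : formal_sum R P) : id (contraaction t) = contraaction (fs_map id t).
  by rewrite fs_map_id.
have [|g gP] := pP (free P) P (ContraHom H) (ContraHom H1).
  by apply: surj_epi => d; exists (fs_unit R d); rewrite /= contra_unit.
by exists g; split=> // t; rewrite hom_contra.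
Qed.
End FreeRetract.

Lemma sval_inj (T : Type) (Q : T -> Prop) (x y : {z | Q z}) : sval x = sval y -> x = y.
Proof. by case: x y => x Qx [y Qy]; exact: eq_exist. Qed.

(** * The projective contramodule of a local idempotent *)

Section LocalIdempotent.
Variables (R : crlTopRingType) (e : R).
Hypothesis loc : local_idempotent e.
Let M := left_ideal_contra e.

Let ee : e * e = e. Proof. by case: loc. Qed.

Lemma left_ideal_mulr (x : M) : sval x * e = sval x.
Proof. by case: x => x [y /= ->]; rewrite -mulrA ee. Qed.

Lemma sval_lincomb X (g : X -> M) t :
  sval (lincomb g t) = topsum (fun x => t x * sval (g x)).
Proof.
rewrite /lincomb /= /regular_action (topsum_fs_map _ _ id).
by rewrite (topsum_fs_map g t sval).
Qed.

Lemma corner_inv_self : corner_invertible e e.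
Proof. by exists e; split=> //; exists e; rewrite ee ee. Qed.

Lemma corner_eq x : corner e x <-> e * x * e = x.
Proof.
split=> [[y ->]|<-]; last by exists x.
by rewrite !mulrA ee -mulrA ee.
Qed.

Definition nonunit : set R := [set x | corner e x /\ ~ corner_invertible e x].

Lemma nonunitB x y : nonunit x -> nonunit y -> nonunit (x - y).
Proof. by case: loc => _ _ _; apply. Qed.

Lemma nonunit0 : nonunit 0. Proof. by case: loc. Qed.

Lemma nonunitD x y : nonunit x -> nonunit y -> nonunit (x + y).
Proof.
move=> nx ny; rewrite -[y]opprK; apply: nonunitB => //; rewrite -sub0r.
by apply: nonunitB => //; exact: nonunit0.
Qed.

(** The radical of the corner ring [e R e] is closed under infinite sums: if the sum
    were a unit, then, after scaling, it would be [e]; removing finitely many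
    terms leaves units, but these tails tend to zero. *)
Lemma nonunit_topsum X (n : X -> R) : zero_convergent n ->
  (forall x, nonunit (n x)) -> nonunit (topsum n).
Proof.
move=> zn nn.
have cn x : e * n x * e = n x by apply/corner_eq; have [] := nn x.
split.
  apply/corner_eq; rewrite -topsum_mull // -topsum_mulr; last exact: zero_convergent_mull.
  by congr topsum; apply/funext => x; rewrite cn.
case=> w [/corner_eq cw mw wm].
have nw x : nonunit (w * n x).
  split; first by apply/corner_eq; rewrite -cw -cn !mulrA ee -mulrA ee.
  case=> y [/corner_eq cy wny ywn]; have [_] := nn x; apply; exists (y * w); split.
  - have ey : e * y = y by rewrite -cy !mulrA ee.
    have we : w * e = w by rewrite -cw -mulrA ee.
    by apply/corner_eq; rewrite mulrA ey -mulrA we.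
  - have ew : e * w = w by rewrite -cw !mulrA ee.
    have en : e * n x = n x by rewrite -cn !mulrA ee.
    have -> : n x = topsum n * (w * n x) by rewrite mulrA mw en.
    by rewrite -mulrA (mulrA (w * n x)) wny ew mw.
  - by rewrite -mulrA.
have zw : zero_convergent (fun x => w * n x) by exact: zero_convergent_mull.
have wE : topsum (fun x => w * n x) = e by rewrite topsum_mull.
have [_ e0 _ _] := loc; apply: e0; apply: ori_sep => I oI; rewrite subr0.
pose F := bad I (fun x => w * n x).
have FI : I (e - \sum_(x <- F) w * n x).
  by rewrite -wE; apply: topsum_approx => // x; exact: badP.
have nF : nonunit (\sum_(x <- F) w * n x).
  by elim/big_ind : _ => //; [exact: nonunit0|exact: nonunitD].
have [y [cy uy yu]] : corner_invertible e (e - \sum_(x <- F) w * n x).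
  apply: contrapT => nu.
  have : nonunit e.
    rewrite -(subrK (\sum_(x <- F) w * n x) e); apply: nonunitD => //; split=> //.
    have [/corner_eq cF _] := nF.
    by apply/corner_eq; rewrite mulrBr mulrBl cF !ee.
  by case=> _; apply; exact: corner_inv_self.
by rewrite -uy; exact: oriM.
Qed.

(** The radical of [R e]: the elements no multiple of which generates [R e]. *)
Definition rad : set M := [set y | forall s, nonunit (e * s * sval y)].

Lemma sub_rad : subcontramodule rad.
Proof.
move=> t s; rewrite -[contraaction _]/(lincomb sval t) sval_lincomb.
have zt := coef_mul_zc t (fun x => sval (sval x)).
rewrite -topsum_mull //; apply: nonunit_topsum; first exact: zero_convergent_mull.
by move=> x; rewrite mulrA -(mulrA e); exact: (svalP x).
Qed.

Definition gen : M := exist _ e (ex_intro _ 1 (esym (mul1r e))).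

Lemma lincomb_gen (x : M) :
  x = lincomb (fun _ : unit => gen) (fs_scale (sval x) (fs_unit R tt)).
Proof.
apply: sval_inj; rewrite sval_lincomb.
by rewrite (topsum_one (x0 := tt)) => [|[]//]; rewrite /= asboolT // mulr1 left_ideal_mulr.
Qed.

Lemma rad_max (A : set M) : subcontramodule A -> ~ (A `<=` rad) -> A = setT.
Proof.
move=> sA /existsNP[y /not_implyP[Ay /existsNP[s ns]]].
have [t [_ _ tE]] : corner_invertible e (e * s * sval y).
  apply: contrapT => ni; apply: ns; split=> //; apply/corner_eq.
  by rewrite !mulrA ee -!mulrA left_ideal_mulr.
have Ag : A gen.
  have -> : gen = lincomb (fun _ : unit => y) (fs_scale (t * (e * s)) (fs_unit R tt)).
    apply: sval_inj; rewrite sval_lincomb.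
    by rewrite (topsum_one (x0 := tt)) => [|[]//]; rewrite /= asboolT // mulr1 -mulrA.
  exact: sub_lincomb.
by apply/seteqP; split=> // x _; rewrite (lincomb_gen x); exact: sub_lincomb.
Qed.

Lemma gen_notin_rad : ~ rad gen.
Proof. by move=> /(_ 1)[_]; rewrite /= mulr1 ee; apply; exact: corner_inv_self. Qed.

(** The restriction to [R e] of the homomorphism out of the free contramodule [R]
    that sends [1] to the combination of the [a x] with coefficients [p]. *)
Lemma left_ideal_hom X (C : contramodule R) (a : X -> C) (p : formal_sum R X) :
  exists h : contra_hom M C, forall x, h x = lincomb a (fs_scale (sval x) p).
Proof.
have H (t : formal_sum R M) : lincomb a (fs_scale (sval (contraaction t)) p) =
    contraaction (fs_map (fun x => lincomb a (fs_scale (sval x) p)) t).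
  rewrite -[RHS]/(lincomb _ t) -lincomb_bind; congr lincomb; apply: formal_sumP => y.
  rewrite contraactionE fs_scaleE sval_lincomb fs_bindE -topsum_mulr.
    by congr topsum; apply/funext => x; rewrite fs_scaleE mulrA.
  exact: coef_mul_zc.
by exists (ContraHom H).
Qed.

Lemma left_ideal_projective : projective M.
Proof.
move=> C D p f /epi_surj sp; have [c pc] := sp (f gen).
have [g gE] := left_ideal_hom (fun _ : unit => c) (fs_unit R tt).
exists g => x; rewrite gE hom_lincomb {2}(lincomb_gen x) hom_lincomb.
by congr lincomb; apply/funext => -[].
Qed.

Lemma left_ideal_cover : exists (S : contramodule R) (p : contra_hom M S),
  simple S /\ projective_cover p.
Proof.
have [S [p [sp pK]]] := quotient_exists sub_rad; exists S, p; split.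
  split; first by exists (p gen) => /pK; exact: gen_notin_rad.
  move=> A sA; pose L : set M := [set c | A (p c)].
  have sL : subcontramodule L.
    move=> t; suff : A (p (lincomb sval t)) by []; rewrite hom_lincomb.
    by apply: sub_lincomb => // -[].
  have [LK|nLK] := pselect (L `<=` rad); [left|right].
    apply/seteqP; split=> [q Aq|q ->]; last exact: sub0.
    by have [c cq] := sp q; rewrite -cq; apply/pK/LK; rewrite /L /= cq.
  have LT := rad_max sL nLK; apply/seteqP; split=> // q _.
  by have [c <-] := sp q; have : L c by rewrite LT.
split; [exact: left_ideal_projective|exact: surj_epi|].
move=> L sL KL; apply: rad_max => // LK; apply: gen_notin_rad.
have [k [l [/pK kK Ll ->]]] := KL gen.
by apply: (subD sub_rad) => //; exact: LK.
Qed.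

End LocalIdempotent.

(** * The decomposition *)

Lemma mat_mul_bind (R : crlTopRingType) W (a b : mat R W) w : (a * b) w = fs_bind (a w) b.
Proof. by apply: formal_sumP => y; rewrite fs_bindE. Qed.

Lemma isomorphic_refl (R : crlTopRingType) (C : contramodule R) : isomorphic C C.
Proof.
have H (t : formal_sum R C) : id (contraaction t) = contraaction (fs_map id t).
  by rewrite fs_map_id.
by exists (ContraHom H), (ContraHom H).
Qed.

Section Decomposition.
Variables (R : crlTopRingType) (P : contramodule R) (g : P -> formal_sum R P).
Hypotheses (gK : forall x, contraaction (g x) = x)
  (g_contra : forall t : formal_sum R P, g (contraaction t) = fs_bind t g).

Let W : Type := (P * option (nat * nat))%type.
Let i (x : P) : W := (x, None).

(** The idempotent endomorphism, with image [P], of the free contramodule on [P];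
    it is placed at the indices [(x, None)]. *)
Definition section_matrix : mat R W :=
  fun w => if w.2 is None then fs_map i (g w.1) else fs_zero R W.

Let f := section_matrix.

Lemma bind_g x : fs_bind (g x) g = g x.
Proof. by rewrite -g_contra gK. Qed.

Lemma bind_i (t : formal_sum R P) (T : W -> formal_sum R W) :
  fs_bind (fs_map i t) T = fs_bind t (T \o i).
Proof.
rewrite fs_mapE fs_bindA; congr fs_bind; apply/funext => x.
by rewrite fs_bind_unit.
Qed.

Lemma bind_f x : fs_bind (g x) (fun y => fs_map i (g y)) = fs_map i (g x).
Proof.
rewrite -{2}bind_g fs_mapE fs_bindA; congr fs_bind; apply/funext => y.
by rewrite fs_mapE.
Qed.

Lemma section_matrix_idem : f * f = f.
Proof.
apply/funext => -[x [p|]]; rewrite mat_mul_bind /f /section_matrix /=.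
  apply: formal_sumP => y; rewrite fs_bindE -[RHS](topsum0 R W).
  by congr topsum; apply/funext => w; rewrite mul0r.
by rewrite bind_i bind_f.
Qed.

Lemma orig_section_matrix : (@orig R P) * f = f.
Proof.
apply: matP => w y; rewrite proj_mul; case: asboolP => //.
by case: w => x [p|] /= // nN; case: nN.
Qed.

Lemma section_matrix_orig : f * (@orig R P) = f.
Proof.
apply: matP => -[x p] [y q]; rewrite mul_proj; case: asboolP => // qN.
rewrite /f /section_matrix; case: p => //=; rewrite -[LHS](topsum0 R P).
congr topsum; apply/funext => z; rewrite /fiber_part asboolF // => -[_ qE].
exact: qN.
Qed.

Section Coproduct.
Variables u v : mat R W.
Hypotheses (uv : u * v = f) (uvu : u * v * u = u) (v_orig : v * (@orig R P) = v).
Variable d : W -> R.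
Hypotheses (vu : v * u = diag d)
  (d_local : forall w, d w <> 0 -> local_idempotent (d w)).

Let J := {w : W | d w <> 0}.
Let F (j : J) : contramodule R := left_ideal_contra (d (sval j)).
Let U x : formal_sum R W := u (i x).

(** Lifting a generator [v w] from [P] back to the free contramodule amounts to
    applying [f], which does not change its coordinates, as [f u = u]. *)
Lemma bind_coord : v * (fun w => fs_bind (g w.1) U) = v * u.
Proof.
rewrite -v_orig -!mulrA.
have -> : (@orig R P) * (fun w => fs_bind (g w.1) U) = f * u.
  apply: matP => -[x p] y; rewrite proj_mul; case: asboolP => [pN|pN].
    by rewrite mat_mul_bind /f /section_matrix pN bind_i.
  by rewrite -orig_section_matrix -mulrA proj_mul asboolF.
have -> : f * u = u by rewrite -uv.
by rewrite [RHS]mulrA v_orig.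
Qed.

Lemma diag_row w : (v * u) w = fs_scale (d w) (fs_unit R w).
Proof.
apply: formal_sumP => y; rewrite vu diagE fs_scaleE /=.
by case: asboolP => _; rewrite ?mulr1 ?mulr0.
Qed.

Lemma u_diag x w : u x w * d w = u x w.
Proof. by rewrite -mul_diag -vu mulrA uvu. Qed.

Lemma inj_exists : exists inj : forall j, contra_hom (F j) P,
  forall j x, inj j x = lincomb fst (fs_scale (sval x) (v (sval j))).
Proof.
pose H (j : J) := cid (left_ideal_hom (d (sval j)) (fst : W -> P) (v (sval j))).
by exists (fun j => sval (H j)) => j; exact: svalP (H j).
Qed.

(** The coordinates [fs_bind (g x) U] of an element [x] of [P] form a
    zero-convergent family of coefficients, with respect to which the images of
    the generators under given homomorphisms can be summed. Conversely, [u v = f]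
    says that each element is the combination of the generators with its
    coordinates as coefficients, so that a homomorphism is determined by its
    values on generators. Indices with [d w = 0] carry the zero element. *)
Lemma coproduct_of_diagonal (inj : forall j, contra_hom (F j) P) :
  (forall j x, inj j x = lincomb fst (fs_scale (sval x) (v (sval j)))) ->
  is_coproduct inj.
Proof.
move=> injE D h; split.
  pose G w : D := match pselect (d w <> 0) with
    | left dw => h (exist _ w dw) (gen (d w))
    | right _ => contra_zero D end.
  have GE (j : J) : G (sval j) = h j (gen (d (sval j))).
    case: j => w dw; rewrite /G /=; case: pselect => // dw'.
    by rewrite (Prop_irrelevance dw' dw).
  pose k (x : P) : D := lincomb G (fs_bind (g x) U).
  have kH (t : formal_sum R P) : k (contraaction t) = contraaction (fs_map k t).
    by rewrite /k g_contra fs_bindA lincomb_bind.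
  exists (ContraHom kH) => j x; rewrite /= injE -[LHS]/(ContraHom kH _) hom_lincomb.
  rewrite -[LHS](lincomb_bind G _ (fun w : W => fs_bind (g w.1) U)) fs_bindZ.
  rewrite -(mat_mul_bind v (fun w : W => fs_bind (g w.1) U)) bind_coord diag_row.
  have dl := d_local (svalP j).
  rewrite {2}(lincomb_gen dl x) hom_lincomb.
  have -> : fs_scale (sval x) (fs_scale (d (sval j)) (fs_unit R (sval j))) =
      fs_scale (sval x) (fs_unit R (sval j)).
    apply: formal_sumP => y; rewrite !fs_scaleE mulrA.
    by rewrite (left_ideal_mulr dl).
  by rewrite lincomb_point GE.
move=> k k' kh kh' c.
pose N w := lincomb (fst : W -> P) (fs_scale (d w) (v w)).
have cE : c = lincomb N (fs_bind (g c) U).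
  rewrite -lincomb_bind.
  have -> : fs_bind (fs_bind (g c) U) (fun w => fs_scale (d w) (v w)) = fs_map i (g c).
    rewrite fs_bindA -bind_f; congr fs_bind; apply/funext => x.
    transitivity ((u * v) (i x)); last by rewrite uv.
    rewrite mat_mul_bind; apply: formal_sumP => y; rewrite !fs_bindE.
    by congr topsum; apply/funext => w; rewrite fs_scaleE mulrA u_diag.
  by rewrite /lincomb fs_map_comp fs_map_id gK.
rewrite cE !hom_lincomb; congr lincomb; apply/funext => w /=.
have [dw|dw] := pselect (d w <> 0).
  have -> : N w = inj (exist _ w dw) (gen (d w)) by rewrite injE.
  by rewrite kh kh'.
have -> : N w = contra_zero P; last by rewrite !hom_zero.
rewrite /N -(lincomb0 (fst : W -> P)); congr lincomb; apply: formal_sumP => y.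
by rewrite fs_scaleE (contrapT dw) mul0r.
Qed.
End Coproduct.
End Decomposition.

Theorem theorem11p1 (R : crlTopRingType) (P : contramodule R) :
  topologically_semiperfect R -> countable_base_at_zero R -> projective P ->
  exists (X : Type) (F : X -> contramodule R)
      (inj : forall x : X, contra_hom (F x) P),
    is_coproduct inj /\
    forall x : X,
      (exists (S : contramodule R) (p : contra_hom (F x) S),
         simple S /\ projective_cover p) /\
      (exists e : R,
         local_idempotent e /\ isomorphic (F x) (left_ideal_contra e)).
Proof.
case=> Z [e [e_zc e_orth e_sum e_local]] cb /projective_section[g [gK gc]].
have ff := section_matrix_idem gK gc.
have of_ := orig_section_matrix g; have fo := section_matrix_orig g.
have [u [v [uv uvu [vu0 vud]]]] :=
  diagonalize_all e_zc e_orth e_sum e_local cb ff of_ fo.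
set f := section_matrix g in ff of_ fo uv.
pose v' := v * f.
have uv' : u * v' = f by rewrite mulrA uv.
have v'u : v' * u = v * u by rewrite -mulrA -uv uvu.
have uv'u : u * v' * u = u by rewrite uv' -uv.
have v'o : v' * (@orig R P) = v' by rewrite -mulrA fo.
pose d w := (v * u) w w.
have v'ud : v' * u = diag d.
  rewrite v'u; apply: matP => x y; rewrite diagE.
  by case: asboolP => [<-//|]; exact: vu0.
have dl w : d w <> 0 -> local_idempotent (d w).
  by case: (vud w) => [//|[z zE] _]; rewrite /d zE.
have [inj injE] := inj_exists v' d.
exists {w | d w <> 0}, (fun j => left_ideal_contra (d (sval j))), inj; split.
  exact: (coproduct_of_diagonal gK gc uv' uv'u v'o v'ud dl).
move=> j; split; first exact/left_ideal_cover/dl/(svalP j).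
by exists (d (sval j)); split; [exact/dl/(svalP j)|exact: isomorphic_refl].
Qed.
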